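(* Let $\gamma>0$ be such that $\sigma\left(A\otimes I+I\otimes A+\frac{1}{\gamma^2}\sum_{k=1}^m N_k\otimes N_k\right)\subset\mathbb C_-$, let $(q_i)_{i=1,\ldots,n}$ be an orthonormal basis of $\mathbb R^n$ of eigenvectors of the Gramian $Q$, and let $0\le t_0<\infty$. Then, for every $i$, $$\left(\int_{t_0}^\infty\|C\Phi(t,t_0)q_i\|_2^2\,dt\right)^{\frac12}\le\mu_i^{\frac12}\exp\left\{0.5\,\|\gamma u^0\|_{L^2}^2\right\},$$ where $\mu_i$ is the eigenvalue of $Q$ associated with $q_i$.
   Context: $A,N_1,\ldots,N_m\in\mathbb R^{n\times n}$, $C\in\mathbb R^{p\times n}$; $A$ is Hurwitz, i.e. $\sigma(A)\subset\mathbb C_-=\{z\in\mathbb C:\Re(z)<0\}$ ($\sigma(\cdot)$ is the spectrum). The control $u=(u_1,\ldots,u_m)^\top:[0,\infty)\to\mathbb R^m$ lies in $L^2$, with $\|f\|_{L^2}^2=\int_0^\infty\|f(s)\|_2^2\,ds$. The function $u^0=(u_1^0,\ldots,u_m^0)^\top$ is given by $u_k^0\equiv0$ if $N_k=0$ and $u_k^0=u_k$ otherwise. The fundamental solution $\Phi(t,s)$, $0\le s\le t$, satisfies $\Phi(t,s)=I+\int_s^tA\Phi(v,s)\,dv+\sum_{k=1}^m\int_s^tN_k\Phi(v,s)u_k(v)\,dv$. The Gramian is $Q=\int_0^\infty Z_\gamma^*(s)\,ds$, where $\dot Z_\gamma^*(t)=A^\top Z_\gamma^*(t)+Z_\gamma^*(t)A+\frac1{\gamma^2}\sum_{k=1}^mN_k^\top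 Z_\gamma^*(t)N_k$, $Z_\gamma^*(0)=C^\top C$; equivalently, $Q$ solves $A^\top Q+QA+\frac1{\gamma^2}\sum_{k=1}^mN_k^\top QN_k=-C^\top C$. *)

(* Defs.v *)
From HB Require Import structures.
From mathcomp Require Import all_boot all_order all_algebra.
From mathcomp Require Import all_classical all_reals all_analysis.
From mathcomp Require Import mxtens complex.

Set Implicit Arguments.
Unset Strict Implicit.
Unset Printing Implicit Defensive.

Import Order.TTheory GRing.Theory Num.Theory.
Import numFieldNormedType.Exports.

Local Open Scope classical_set_scope.
Local Open Scope ring_scope.

(* The spectrum is that of the complexification; [eigenvalue] is phrased with
   row (left) eigenvectors, which yields the same set. *)
Definition hurwitz (R : realType) (n : nat) (M : 'M[R]_n) : Prop :=
  forall z : complex R,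
    eigenvalue (map_mx (real_complex R) M) z -> complex.Re z < 0.

Definition norm2 (R : realType) (n : nat) (v : 'cV[R]_n) : R :=
  Num.sqrt (\sum_i v i ord0 ^+ 2).

Definition L2norm (R : realType) (m : nat) (f : R -> 'cV[R]_m) : \bar R :=
  sqrte (\int[@lebesgue_measure R]_(s in `[0%R, +oo[) (norm2 (f s) ^+ 2)%:E)%E.

Definition in_L2 (R : realType) (m : nat) (f : R -> 'cV[R]_m) : Prop :=
  (forall k, measurable_fun (`[0, +oo[ : set R) (fun s => f s k ord0)) /\
  (L2norm f < +oo)%E.

Definition mx_integrable (R : realType) (m n : nat) (D : set R)
    (F : R -> 'M[R]_(m, n)) : Prop :=
  forall i j, (@lebesgue_measure R).-integrable D (fun v => (F v i j)%:E).

Definition mx_integral (R : realType) (m n : nat) (D : set R)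
    (F : R -> 'M[R]_(m, n)) : 'M[R]_(m, n) :=
  \matrix_(i, j) Rintegral (@lebesgue_measure R) D (fun v => F v i j).

(* Since [Rintegral] is total, the existence of the integrals occurring in the
   integral equation is part of being a solution; continuity of [Phi ^~ s] is
   then a consequence of the equation. *)
Definition fundamental_solution (R : realType) (n m : nat) (A : 'M[R]_n)
    (N : 'I_m -> 'M[R]_n) (u : R -> 'cV[R]_m) (Phi : R -> R -> 'M[R]_n) : Prop :=
  forall s t : R, 0 <= s -> s <= t ->
    [/\ mx_integrable `[s, t] (fun v => A *m Phi v s),
        forall k, mx_integrable `[s, t] (fun v => u v k ord0 *: (N k *m Phi v s))
      & Phi t s = 1%:M + mx_integral `[s, t] (fun v => A *m Phi v s)
          + \sum_k mx_integral `[s, t] (fun v => u v k ord0 *: (N k *m Phi v s))].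

Definition active_control (R : realType) (n m : nat) (N : 'I_m -> 'M[R]_n)
    (u : R -> 'cV[R]_m) : R -> 'cV[R]_m :=
  fun t => \col_k (if N k == 0 then 0 else u t k ord0).

Definition dual_lyapunov_op (R : realType) (n m : nat) (A : 'M[R]_n)
    (N : 'I_m -> 'M[R]_n) (gamma : R) (X : 'M[R]_n) : 'M[R]_n :=
  A^T *m X + X *m A + (gamma ^+ 2)^-1 *: \sum_k ((N k)^T *m X *m N k).

(* Only the values of [Z] on [0, +oo[ matter: continuity there, and the
   differential equation on ]0, +oo[, which gives the one-sided one at 0. *)
Definition dual_lyapunov_flow (R : realType) (n m p : nat) (A : 'M[R]_n)
    (N : 'I_m -> 'M[R]_n) (C : 'M[R]_(p, n)) (gamma : R) (Z : R -> 'M[R]_n) : Prop :=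
  [/\ Z 0 = C^T *m C,
      forall i j, {within `[0, +oo[, continuous (fun s : R => Z s i j)}
    & forall t : R, 0 < t -> forall i j,
        is_derive t 1 (fun s : R => Z s i j) (dual_lyapunov_op A N gamma (Z t) i j)].

(* A family of n orthonormal vectors of R^n is automatically a basis. *)
Definition orthonormal_basis (R : realType) (n : nat) (q : 'I_n -> 'cV[R]_n) : Prop :=
  forall i j, (q i)^T *m q j = (i == j)%:R%:M.

(* Main.v *)
Require Import Defs.
From HB Require Import structures.
From mathcomp Require Import all_boot all_order all_algebra.
From mathcomp Require Import all_classical all_reals all_analysis.
From mathcomp Require Import measurable_realfun.
From mathcomp Require Import mxtens complex.
From mathcomp Require Import ring lra.

Set Implicit Arguments.
Unset Strict Implicit.
Unset Printing Implicit Defensive.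

Import Order.TTheory GRing.Theory Num.Theory.
Import numFieldNormedType.Exports.

Local Open Scope classical_set_scope.
Local Open Scope ring_scope.

(** Put [V(x) = x^T Q x] along [x(t) = Phi(t, t0) q_i]. The Lyapunov equation for
    [Q] and Young's inequality in the seminorm of [Q] give
    [V' + |C x|^2 <= |gamma u^0|^2 V] almost everywhere, so Gronwall's lemma for
    [V(t) + int_t0^t |C x|^2] bounds the energy by [mu_i exp(|gamma u^0|_L2^2)].
    Since [u] is only square integrable, [V] is merely absolutely continuous, and
    the product rule and Gronwall's lemma are proved for indefinite Lebesgue
    integrals. That [Z] is integrable, so that [Q] solves the Lyapunov equation,
    follows from the exponential decay of [y' = y K] for Hurwitz [K]; that [Q] is
    positive semidefinite follows from a minimum principle for the flow [Z]. *)

(** * Exponential decay of Hurwitz linear flows *)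

(** The weights in Young's inequality are forced: the quadratic term in [N_k] has to be absorbed
    exactly by the [gamma^-2] term of the Lyapunov equation, and what is left over is
    [(gamma u_k)^2 V]. The form of [Q] is evaluated there at vectors other than [x], so the
    positivity of [Q] has to be settled before the energy estimate. Gronwall's lemma may not lose a
    constant either: the factor [0.5] is its exact exponent, halved by the final square root.
    Vectors are written as rows, so that vectorising the flow [Z] produces [y' = y K] with the very
    [K] of the spectral hypothesis. [Z] is handled through its differential equation alone: decay is
    reduced to forced scalar equations by complex matrices commuting with [K], without a matrix
    exponential or a Jordan form, and positivity does not presuppose that [Z] is symmetric. *)

Lemma continuous_expRM (R : realType) (k : R) :
  continuous (fun t : R => expR (k * t)).
Proof.
move=> t; apply: continuous_comp; last exact: continuous_expR.
exact: mulrl_continuous.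
Qed.

Lemma is_derive_expRM (R : realType) (k t : R) :
  is_derive t 1 (fun s : R => expR (k * s)) (k * expR (k * t)).
Proof.
have : is_derive t 1 (fun s : R => k * s) k.
  by apply: is_derive_eq; rewrite /GRing.scale /=; ring.
by move=> ?; apply: is_derive_eq; rewrite mulrC.
Qed.

(** This is the complex scalar equation [f' = (a + i b) f + g] split into real and imaginary parts.
    Young's inequality [2 Re (conj f g) <= - a |f|^2 - a^-1 |g|^2] spends half of the damping
    [2 a |f|^2]; the other half pays for the weight [expR (be * t)], as [be < - a]. *)
Lemma exp_decay_forced (R : realType) (fR fI gR gI : R -> R) (a b al c : R) :
  a < 0 -> 0 < al -> continuous fR -> continuous fI ->
  (forall t : R, 0 < t -> is_derive t 1 fR (a * fR t - b * fI t + gR t)) ->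
  (forall t : R, 0 < t -> is_derive t 1 fI (b * fR t + a * fI t + gI t)) ->
  (forall t : R, 0 <= t -> gR t ^+ 2 + gI t ^+ 2 <= c * expR (- al * t)) ->
  exists c' al' : R, 0 < al' /\
    forall t : R, 0 <= t -> fR t ^+ 2 + fI t ^+ 2 <= c' * expR (- al' * t).
Proof.
move=> a0 al0 cR cI dR dI hg.
pose be := Num.min al (- a) / 2.
have [be0 beal bea] : [/\ 0 < be, be < al & be < - a].
  have m0 : 0 < Num.min al (- a) by rewrite lt_min al0 oppr_gt0.
  have : Num.min al (- a) <= al by rewrite ge_min lexx.
  have : Num.min al (- a) <= - a by rewrite ge_min lexx orbT.
  by rewrite /be => ? ?; split; lra.
have c0 : 0 <= c.
  by have := hg 0 (lexx _); rewrite mulr0 expR0; nra.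
(* [D] solves [D (be - al) = c / a]: the derivative of the second term of [H] then compensates the
   forcing left over by Young's inequality, and [H] is nonincreasing. *)
pose D := c / ((- a) * (al - be)).
have D0 : 0 <= D by rewrite divr_ge0 // mulr_ge0 //; lra.
pose H t := (fR t ^+ 2 + fI t ^+ 2) * expR (be * t) + D * expR ((be - al) * t).
have dH (t : R) : 0 < t -> is_derive t 1 H
    ((2 * fR t * (a * fR t - b * fI t + gR t)
      + 2 * fI t * (b * fR t + a * fI t + gI t)) * expR (be * t)
     + (fR t ^+ 2 + fI t ^+ 2) * (be * expR (be * t))
     + D * ((be - al) * expR ((be - al) * t))).
  move=> t0; have ? := dR _ t0; have ? := dI _ t0.
  have ? := is_derive_expRM be t; have ? := is_derive_expRM (be - al) t.
  apply: is_derive_eq.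
  rewrite /GRing.scale /=; ring.
have dH0 (t : R) : 0 < t ->
    (2 * fR t * (a * fR t - b * fI t + gR t)
      + 2 * fI t * (b * fR t + a * fI t + gI t)) * expR (be * t)
     + (fR t ^+ 2 + fI t ^+ 2) * (be * expR (be * t))
     + D * ((be - al) * expR ((be - al) * t)) <= 0.
  move=> t0.
  have -> : expR ((be - al) * t) = expR (be * t) * expR (- al * t).
    by rewrite -expRD; congr expR; ring.
  have E0 := expR_gt0 (be * t).
  have hgt := hg _ (ltW t0).
  have DE : D * (be - al) = c / a by rewrite /D; field; apply/andP; split; lra.
  rewrite [X in X <= _](_ : _ = expR (be * t) *
    (2 * a * (fR t ^+ 2 + fI t ^+ 2) + 2 * (fR t * gR t + fI t * gI t)
      + be * (fR t ^+ 2 + fI t ^+ 2) + (D * (be - al)) * expR (- al * t))); last ring.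
  rewrite pmulr_rle0 // DE.
  have young (x y : R) : 2 * (x * y) <= - a * x ^+ 2 - a^-1 * y ^+ 2.
    have : 0 <= - a^-1 * (a * x + y) ^+ 2.
      by rewrite mulr_ge0 ?sqr_ge0 // oppr_ge0 invr_le0 ltW.
    have -> : - a^-1 * (a * x + y) ^+ 2
        = - a * x ^+ 2 - a^-1 * y ^+ 2 - 2 * (x * y) by field; lra.
    by rewrite subr_ge0.
  have := young (fR t) (gR t); have := young (fI t) (gI t).
  have : - a^-1 * (gR t ^+ 2 + gI t ^+ 2) <= - a^-1 * (c * expR (- al * t)).
    by rewrite ler_wpM2l // oppr_ge0 invr_le0 ltW.
  have := sqr_ge0 (fR t); have := sqr_ge0 (fI t).
  set x := fR t; set y := fI t; set z := gR t; set w := gI t.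
  have : be * (x ^+ 2 + y ^+ 2) <= - a * (x ^+ 2 + y ^+ 2).
    by rewrite ler_wpM2r ?addr_ge0 ?sqr_ge0 // ltW.
  lra.
have cH : continuous H.
  move=> t; apply: cvgD; apply: cvgM.
  - by apply: cvgD; apply: cvgM; [exact: cR|exact: cR|exact: cI|exact: cI].
  - exact: continuous_expRM.
  - exact: cvg_cst.
  - exact: continuous_expRM.
exists (H 0), be; split=> // t t0.
have : H t <= H 0.
  apply: (@ler0_derive1_nincry R H 0) => //.
  - by move=> x; rewrite in_itv /= andbT => x0; have [] := dH _ x0.
  - move=> x; rewrite in_itv /= andbT => x0.
    by rewrite derive1E; have [_ ->] := dH _ x0; exact: dH0.
  - exact: continuous_subspaceT.
rewrite {1}/H => Ht.
have E0 := expR_gt0 (- be * t).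
have : (fR t ^+ 2 + fI t ^+ 2) * expR (be * t) <= H 0.
  apply: le_trans Ht; rewrite lerDl mulr_ge0 // expR_ge0 //.
move=> /(ler_wpM2r (ltW E0)); rewrite -mulrA -expRD.
by rewrite [X in expR X](_ : _ = 0) ?expR0 ?mulr1 //; ring.
Qed.

Lemma is_derive_sumE (R : realType) (I : finType) (F : I -> R -> R)
    (dF : I -> R) (t : R) :
  (forall i, is_derive t 1 (F i) (dF i)) ->
  is_derive t 1 (fun s => \sum_i F i s) (\sum_i dF i).
Proof.
move=> h; rewrite -fct_sumE.
elim/big_ind2 : _ => [|f df g dg hf hg|i _]; last exact: h.
  exact: is_derive_cst.
exact: is_deriveD.
Qed.

Lemma continuous_sumE (R : realType) (T : topologicalType) (I : finType)
    (F : I -> T -> R) :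
  (forall i, continuous (F i)) -> continuous (fun s => \sum_i F i s).
Proof.
move=> h; rewrite -fct_sumE; elim/big_ind : _ => // [x|f g cf cg x].
  exact: cvg_cst.
exact: cvgD (cf x) (cg x).
Qed.

Section linear_flow_decay.
Variables (R : realType) (k : nat) (K : 'M[R]_k) (y : R -> 'rV[R]_k).
Hypothesis cy : forall j, continuous (fun t => y t 0 j).
Hypothesis dy : forall t : R, 0 < t -> forall j,
  is_derive t 1 (fun s => y s 0 j) ((y t *m K) 0 j).

Let cplx n1 n2 (M : 'M[R]_(n1, n2)) := map_mx (real_complex R) M.
Let w (B : 'M[complex R]_k) (t : R) := cplx (y t) *m B.

(** The induction in [hurwitz_exp_decay] runs over [B], from a vanishing polynomial in [K] down to
    the identity. Squared moduli keep the estimate real, as in [exp_decay_forced]. *)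
Definition decaying (B : 'M[complex R]_k) := forall j, exists c a : R, 0 < a /\
  forall t : R, 0 <= t ->
    complex.Re (w B t 0 j) ^+ 2 + complex.Im (w B t 0 j) ^+ 2
      <= c * expR (- a * t).

Let ReE (v : 'rV[R]_k) (B : 'M[complex R]_k) j :
  complex.Re ((cplx v *m B) 0 j) = \sum_l v 0 l * complex.Re (B l j).
Proof.
rewrite mxE raddf_sum /=; apply: eq_bigr => l _; rewrite !mxE.
by case: (B l j) => a b /=; rewrite mul0r subr0.
Qed.

Let ImE (v : 'rV[R]_k) (B : 'M[complex R]_k) j :
  complex.Im ((cplx v *m B) 0 j) = \sum_l v 0 l * complex.Im (B l j).
Proof.
rewrite mxE raddf_sum /=; apply: eq_bigr => l _; rewrite !mxE.
by case: (B l j) => a b /=; rewrite mul0r addr0.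
Qed.

Let derE (c : 'I_k -> R) (t : R) : 0 < t -> is_derive t 1
  (fun s => \sum_l y s 0 l * c l) (\sum_l (y t *m K) 0 l * c l).
Proof.
move=> t0; apply: is_derive_sumE => l; have ? := dy t0 l.
by apply: is_derive_eq; rewrite /GRing.scale /=; ring.
Qed.

Let contE (c : 'I_k -> R) : continuous (fun s : R => \sum_l y s 0 l * c l).
Proof.
apply: continuous_sumE => l t; apply: cvgM; [exact: cy|exact: cvg_cst].
Qed.

(** Since [B] commutes with [K], [(y B)' = y K B = z (y B) + y B (K - z)]: each coordinate of [y B]
    solves a scalar equation with damping [Re z < 0], forced by a term that decays by assumption. *)
Lemma decaying_peel (B : 'M[complex R]_k) (z : complex R) :
  complex.Re z < 0 -> comm_mx (cplx K) B ->
  decaying (B *m (cplx K - z%:M)) -> decaying B.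
Proof.
move=> z0 KB hB j; have [c [a [a0 h]]] := hB j.
have wE t : (cplx (y t *m K) *m B) 0 j
    = z * w B t 0 j + w (B *m (cplx K - z%:M)) t 0 j.
  rewrite /w mulmxBr mul_mx_scalar -KB mulmxBr mulmxA -scalemxAr.
  rewrite (_ : cplx (y t *m K) = cplx (y t) *m cplx K); last exact: map_mxM.
  set M1 := (X in X 0 j = _); set M2 := (X in z * X 0 j).
  by rewrite [X in _ + X]mxE [X in _ + (_ + X)]mxE [X in - X]mxE subrKC.
have ReD (x1 x2 : complex R) :
    complex.Re (x1 + x2) = complex.Re x1 + complex.Re x2.
  by case: x1 x2 => [? ?] [? ?].
have ImD (x1 x2 : complex R) :
    complex.Im (x1 + x2) = complex.Im x1 + complex.Im x2.
  by case: x1 x2 => [? ?] [? ?].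
have Remul (x1 x2 : complex R) : complex.Re (x1 * x2)
    = complex.Re x1 * complex.Re x2 - complex.Im x1 * complex.Im x2.
  by case: x1 x2 => [? ?] [? ?].
have Immul (x1 x2 : complex R) : complex.Im (x1 * x2)
    = complex.Im x1 * complex.Re x2 + complex.Re x1 * complex.Im x2.
  by case: x1 x2 => [? ?] [? ?] /=; rewrite addrC.
apply: (@exp_decay_forced R (fun t => complex.Re (w B t 0 j))
  (fun t => complex.Im (w B t 0 j))
  (fun t => complex.Re (w (B *m (cplx K - z%:M)) t 0 j))
  (fun t => complex.Im (w (B *m (cplx K - z%:M)) t 0 j)) _ (complex.Im z) _ c
  z0 a0 _ _ _ _ h).
- rewrite (_ : (fun t => _) = fun t => \sum_l y t 0 l * complex.Re (B l j)).
    exact: contE.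
  by apply/funext => t; rewrite -ReE.
- rewrite (_ : (fun t => _) = fun t => \sum_l y t 0 l * complex.Im (B l j)).
    exact: contE.
  by apply/funext => t; rewrite -ImE.
- move=> t t0; 
  have -> : complex.Re z * complex.Re (w B t 0 j)
      - complex.Im z * complex.Im (w B t 0 j)
      + complex.Re (w (B *m (cplx K - z%:M)) t 0 j)
      = complex.Re ((cplx (y t *m K) *m B) 0 j) by rewrite wE ReD Remul.
  rewrite ReE.
  rewrite (_ : (fun t => _) = fun t => \sum_l y t 0 l * complex.Re (B l j)).
    exact: derE.
  by apply/funext => s; rewrite -ReE.
- move=> t t0; 
  have -> : complex.Im z * complex.Re (w B t 0 j)
      + complex.Re z * complex.Im (w B t 0 j)
      + complex.Im (w (B *m (cplx K - z%:M)) t 0 j)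
      = complex.Im ((cplx (y t *m K) *m B) 0 j) by rewrite wE ImD Immul.
  rewrite ImE.
  rewrite (_ : (fun t => _) = fun t => \sum_l y t 0 l * complex.Im (B l j)).
    exact: derE.
  by apply/funext => s; rewrite -ImE.
Qed.

End linear_flow_decay.

(* By Cayley-Hamilton, the product of the [K - z] over the roots [z] of the
   characteristic polynomial vanishes; peel these factors off one by one. *)
Lemma hurwitz_exp_decay (R : realType) (k : nat) (K : 'M[R]_k)
    (y : R -> 'rV[R]_k) :
  hurwitz K -> (forall j, continuous (fun t => y t 0 j)) ->
  (forall t : R, 0 < t -> forall j,
    is_derive t 1 (fun s => y s 0 j) ((y t *m K) 0 j)) ->
  exists c a : R, 0 < a /\
    forall (t : R) (j : 'I_k), 0 <= t -> `|y t 0 j| <= c * expR (- a * t).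
Proof.
case: k K y => [|k] K y hK cy dy; first by exists 0, 1; split=> // t [].
have decay1 : decaying y 1%:M.
  pose Kc := map_mx (real_complex R) K.
  have [rs Ers] := closed_field_poly_normal (char_poly Kc).
  have lc : lead_coef (char_poly Kc) = 1 by exact: (monicP (char_poly_monic _)).
  rewrite lc scale1r in Ers.
  have rs_neg z : z \in rs -> complex.Re z < 0.
    move=> zrs; apply: hK; rewrite eigenvalue_root_char Ers.
    by rewrite root_prod_XsubC.
  have := Cayley_Hamilton Kc; rewrite Ers => CH.
  have : decaying y (horner_mx Kc (\prod_(z <- rs) ('X - z%:P))).
    rewrite CH => j; exists 0, 1; split=> // t _.
    by rewrite mulmx0 !mxE /= expr0n addr0 mul0r.
  elim: rs rs_neg {Ers CH} => [|z rs IH] hrs.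
    by rewrite big_nil rmorph1.
  rewrite big_cons mulrC rmorphM /= rmorphB /= horner_mx_X horner_mx_C => hd.
  apply: IH; first by move=> ? ?; apply: hrs; rewrite inE orbC; apply/orP; left.
  apply: (decaying_peel cy dy (hrs z _)) hd; first by rewrite inE eqxx.
  exact: comm_mx_horner.
have decayj (j : 'I_k.+1) : exists ca : R * R, 0 < ca.2 /\
    forall t : R, 0 <= t -> `|y t 0 j| <= ca.1 * expR (- ca.2 * t).
  have [c [a [a0 h]]] := decay1 j.
  exists (Num.sqrt c, a / 2); split=> [|t t0] /=; first by rewrite divr_gt0.
  have := h t t0; rewrite mulmx1 mxE /= expr0n addr0 => ht.
  rewrite -sqrtr_sqr.
  have c0 : 0 <= c.
    by rewrite -(pmulr_lge0 _ (expR_gt0 (- a * t))) (le_trans _ ht) ?sqr_ge0.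
  have -> : expR (- (a / 2) * t) = Num.sqrt (expR (- a * t)).
    rewrite -[RHS](_ : Num.sqrt (expR (- (a / 2) * t) ^+ 2) = _).
      by rewrite sqrtr_sqr ger0_norm // expR_ge0.
    by congr Num.sqrt; rewrite expr2 -expRD; congr expR; field.
  by rewrite -sqrtrM // ler_wsqrtr.
have [f hf] := choice decayj.
exists (\sum_j `|(f j).1|), (\big[Num.min/1]_j (f j).2); split.
  by elim/big_ind : _ => // [? ? ? ?|j _]; rewrite ?lt_min; [apply/andP|case: (hf j)].
move=> t j t0; have [_ /(_ t t0)/le_trans] := hf j; apply.
apply: (@le_trans _ _ (`|(f j).1| * expR (- (f j).2 * t))).
  by rewrite ler_wpM2r ?expR_ge0 // ler_norm.
apply: ler_pM; rewrite ?expR_ge0 //.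
  by rewrite (bigD1 j) //= lerDl sumr_ge0.
rewrite ler_expR !mulNr lerN2 ler_wpM2r //.
by rewrite (bigD1 j) //= ge_min lexx.
Qed.

(** * The Lyapunov equation of the Gramian *)

Section finite_sum_Rintegral.
Context d (T : measurableType d) (R : realType) (mu : {measure set T -> \bar R}).
Variables (I : finType) (D : set T) (F : I -> T -> R).
Hypothesis mD : measurable D.
Hypothesis iF : forall i, mu.-integrable D (EFin \o F i).

Lemma integrable_sumE : mu.-integrable D (fun x => (\sum_i F i x)%:E).
Proof.
rewrite (_ : (fun x => _) = fun x => (\sum_(i <- index_enum I) (EFin \o F i) x)%E).
  exact: integrable_sum.
by apply/funext => x; rewrite sumEFin.
Qed.

Lemma Rintegral_sumE : Rintegral mu D (fun x => \sum_i F i x)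
  = \sum_i Rintegral mu D (F i).
Proof.
rewrite /Rintegral; under eq_integral do rewrite -sumEFin.
rewrite integral_sum // sum_fine // => i _.
by have := integrable_fin_num mD (iF i).
Qed.

End finite_sum_Rintegral.

(** * Improper integrals of exponentially dominated functions *)

Lemma cvg_expRNM (R : realType) (a : R) : 0 < a ->
  expR (- a * t) @[t --> +oo] --> (0 : R).
Proof.
move=> a0; apply/cvgrPdist_le => e e0; near=> t.
rewrite sub0r normrN ger0_norm ?expR_ge0 //.
have t0 : 0 < t by near: t; exact: nbhs_pinfty_gt.
have : (a * e)^-1 <= t by near: t; apply: nbhs_pinfty_ge; exact: num_real.
rewrite -(ler_pM2l (mulr_gt0 a0 e0)) divff ?mulf_neq0 ?gt_eqF // => h.
rewrite mulNr expRN invf_ple ?posrE ?expR_gt0 //.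
rewrite (@le_trans _ _ (a * t)) //.
  rewrite -(ler_pM2l e0) divff ?gt_eqF //.
  by rewrite mulrCA mulrA.
by rewrite (le_trans _ (expR_ge1Dx _)) // lerDr.
Unshelve. all: by end_near. Qed.

Section exponential_FTC.
Variable R : realType.
Local Notation leb := (@lebesgue_measure R).

Lemma integral_expRNM (a : R) : 0 < a ->
  (\int[leb]_(x in `[0%R, +oo[) (expR (- a * x))%:E = (a^-1)%:E)%E.
Proof.
move=> a0; have aN0 : a != 0 by rewrite gt_eqF.
have dF (t : R) : is_derive t 1 (fun t => - a^-1 * expR (- a * t)) (expR (- a * t)).
  have ? := is_derive_expRM (- a) t.
  by apply: is_derive_eq; rewrite /GRing.scale /=; field.
have cF : continuous (fun t : R => - a^-1 * expR (- a * t)).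
  by move=> t; apply: cvgM; [exact: cvg_cst|exact: continuous_expRM].
rewrite (@ge0_continuous_FTC2y R _ (fun t => - a^-1 * expR (- a * t)) 0 0) //.
- by rewrite mulr0 expR0 mulr1 -EFinB sub0r opprK.
- apply: continuous_subspaceT; exact: continuous_expRM.
- by rewrite -[X in _ --> X](mulr0 (- a^-1)); apply: cvgM; [exact: cvg_cst|exact: cvg_expRNM].
- by apply: cvg_at_right_filter; exact: cF.
- by move=> x _; rewrite derive1E; have [_ ->] := dF x.
Qed.

Lemma integrable_expRNM (c a : R) : 0 < a ->
  leb.-integrable `[0, +oo[ (fun t => (c * expR (- a * t))%:E).
Proof.
move=> a0.
suff h : leb.-integrable `[0, +oo[ (fun t => (expR (- a * t))%:E).
  by apply: (integrableZl _ c h).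
apply/integrableP; split.
  apply/measurable_EFinP; apply: measurable_funTS.
  by apply: continuous_measurable_fun; exact: continuous_expRM.
under eq_integral do rewrite gee0_abs ?lee_fin ?expR_ge0 //.
by rewrite integral_expRNM // ltry.
Qed.

Lemma exp_dominated_integrable (f : R -> R) (c a : R) : 0 < a -> continuous f ->
  (forall t : R, 0 <= t -> `|f t| <= c * expR (- a * t)) ->
  leb.-integrable `[0, +oo[ (EFin \o f).
Proof.
move=> a0 cf hf; apply: le_integrable (integrable_expRNM c a0) => //.
  apply/measurable_EFinP; apply: measurable_funTS.
  exact: continuous_measurable_fun.
move=> t; rewrite /= in_itv /= andbT => t0.
by rewrite lee_fin (le_trans (hf t t0)) // ler_norm.
Qed.

(** As [f] has no sign, the fundamental theorem is applied to [f + c expR (- a t)], which is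
    nonnegative by domination and has primitive [G]; the integral [c / a] of the added exponential
    is removed at the end. *)
Lemma exp_dominated_FTC2y (f F : R -> R) (c a c' a' : R) :
  0 < a -> 0 < a' -> continuous f -> continuous F ->
  (forall t : R, 0 < t -> is_derive t 1 F (f t)) ->
  (forall t : R, 0 <= t -> `|f t| <= c * expR (- a * t)) ->
  (forall t : R, 0 <= t -> `|F t| <= c' * expR (- a' * t)) ->
  Rintegral leb `[0, +oo[ f = - F 0.
Proof.
move=> a0 a'0 cf cF dF hf hF; have aN0 : a != 0 by rewrite gt_eqF.
have if_ := exp_dominated_integrable a0 cf hf.
have ie := integrable_expRNM c a0.
pose G t := F t - c / a * expR (- a * t).
have dG (t : R) : 0 < t -> is_derive t 1 G (f t + c * expR (- a * t)).
  move=> t0; have ? := dF t t0; have ? := is_derive_expRM (- a) t.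
  by apply: is_derive_eq; rewrite /GRing.scale /=; field.
have cG : continuous G.
  move=> t; apply: cvgB; first exact: cF.
  by apply: cvgM; [exact: cvg_cst|exact: continuous_expRM].
have F0 : F t @[t --> +oo] --> (0 : R).
  apply/norm_cvg0P.
  have h : c' * expR (- a' * t) @[t --> +oo] --> (0 : R).
    by rewrite -[X in _ --> X](mulr0 c'); apply: cvgM; [exact: cvg_cst|exact: cvg_expRNM].
  apply: (@squeeze_cvgr _ _ _ _ (cst 0) _ _ _ _ _ h); last exact: cvg_cst.
  near=> t; rewrite normr_ge0 /=; apply: hF.
  by near: t; apply: nbhs_pinfty_ge; exact: num_real.
have : Rintegral leb `[0, +oo[ (fun t => f t + c * expR (- a * t)) = 0 - G 0.
  apply: Rintegral_ge0_continuous_FTC2y.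
  - move=> x x0; have := hf x x0; rewrite ler_norml => /andP[+ _].
    by rewrite -subr_ge0 opprK.
  - apply: continuous_subspaceT => t; apply: cvgD; first exact: cf.
    by apply: cvgM; [exact: cvg_cst|exact: continuous_expRM].
  - rewrite -[X in _ --> X](subr0 0) -[X in _ - X](mulr0 (c / a)).
    apply: cvgB => //.
    by apply: cvgM; [exact: cvg_cst|exact: cvg_expRNM].
  - by move=> x x0; have [] := dG x x0.
  - by apply: cvg_at_right_filter; exact: cG.
  - move=> x; rewrite in_itv /= andbT => x0.
    by rewrite derive1E; have [_ ->] := dG x x0.
rewrite RintegralD // RintegralZl //; last first.
  have := integrable_expRNM 1 a0; congr (_.-integrable _ _).
  by apply/funext => t; rewrite mul1r.
have -> : Rintegral leb `[0, +oo[ (fun t => expR (- a * t)) = a^-1.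
  by rewrite /Rintegral integral_expRNM.
rewrite /G mulr0 expR0 => h.
by apply: (addIr (c / a)); rewrite h; ring.
Unshelve. all: by end_near. Qed.

End exponential_FTC.

(** * Vectorisation of the dual Lyapunov operator *)

Section dual_lyapunov.
Variables (R : realType) (n m : nat) (A : 'M[R]_n) (N : 'I_m -> 'M[R]_n).
Variable gamma : R.

Let K : 'M[R]_(n * n) := tensmx A 1%:M + tensmx 1%:M A
  + (gamma ^+ 2)^-1 *: \sum_k tensmx (N k) (N k).

Let vec (X : 'M[R]_n) : 'rV[R]_(n * n) :=
  \row_l X (mxtens_unindex l).1 (mxtens_unindex l).2.

(** Listing entries along [mxtens_index] turns [X |-> B^T X D] into right multiplication by
    [tensmx B D], so the matrix of the spectral hypothesis appears without a transpose. *)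
Lemma dual_lyapunov_opE X i j :
  dual_lyapunov_op A N gamma X i j = (vec X *m K) 0 (mxtens_index (i, j)).
Proof.
have sumE (B D : 'M[R]_n) : (B^T *m X *m D) i j
    = \sum_l vec X 0 l * tensmx B D l (mxtens_index (i, j)).
  rewrite (reindex (@mxtens_index n n)) /=; last first.
    exists (@mxtens_unindex n n) => ? _; [exact: mxtens_indexK|exact: mxtens_unindexK].
  pose G a b := vec X 0 (mxtens_index (a, b))
    * tensmx B D (mxtens_index (a, b)) (mxtens_index (i, j)).
  rewrite [RHS](eq_bigr (fun p => G p.1 p.2)); last by case.
  rewrite -(pair_bigA _ G) /=.
  rewrite mxE exchange_big /=; apply: eq_bigr => b _.
  rewrite mxE mulr_suml; apply: eq_bigr => a _.
  by rewrite /G !mxE !mxtens_indexK /=; ring.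
have A1 : A^T *m X = A^T *m X *m 1%:M by rewrite mulmx1.
have A2 : X *m A = 1%:M^T *m X *m A by rewrite trmx1 mul1mx.
rewrite /dual_lyapunov_op A1 A2 [LHS]mxE [X in X + _]mxE.
rewrite [X in _ + X = _]mxE summxE !sumE.
under [X in _ * X]eq_bigr do rewrite sumE.
rewrite exchange_big /= mulr_sumr -!big_split /= [RHS]mxE.
apply: eq_bigr => l _; rewrite /K [X in _ = _ * X]mxE [X in _ = _ * (X + _)]mxE.
rewrite [X in _ = _ * (_ + X)]mxE summxE -mulr_sumr.
by rewrite !mulrDr mulrCA.
Qed.

Variable Z : R -> 'M[R]_n.
Hypothesis cZ : forall i j, continuous (fun t => Z t i j).
Hypothesis dZ : forall t : R, 0 < t -> forall i j,
  is_derive t 1 (fun s => Z s i j) (dual_lyapunov_op A N gamma (Z t) i j).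
Hypothesis hK : hurwitz K.

Let vecE X i j : vec X 0 (mxtens_index (i, j)) = X i j.
Proof. by rewrite mxE mxtens_indexK. Qed.

Let idx (l : 'I_(n * n)) : exists i j, l = mxtens_index (i, j).
Proof. by case: (mxtens_indexP l) => i j; exists i, j. Qed.

Let cv l : continuous (fun t => vec (Z t) 0 l).
Proof.
have [i [j ->]] := idx l.
by rewrite (_ : (fun t => _) = fun t => Z t i j) //; apply/funext => t; rewrite vecE.
Qed.

Let decay : exists c a : R, 0 < a /\
  forall (t : R) l, 0 <= t -> `|vec (Z t) 0 l| <= c * expR (- a * t).
Proof.
apply: hurwitz_exp_decay hK _ _ => // t t0 l.
have [i [j ->]] := idx l; rewrite -dual_lyapunov_opE.
by rewrite (_ : (fun t => _) = fun t => Z t i j) //; [exact: dZ|apply/funext => s; rewrite vecE].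
Qed.

Lemma dual_flow_integrable i j :
  (@lebesgue_measure R).-integrable `[0, +oo[ (fun t => (Z t i j)%:E).
Proof.
have [c [a [a0 h]]] := decay.
apply: (exp_dominated_integrable a0 (@cZ i j)) => t t0.
by rewrite -vecE; exact: h.
Qed.

(** Integrate [Z' = L Z] over the half-line: decay leaves [- Z 0] on one side, and on the other [L],
    a finite linear combination of entries, commutes with the integral. *)
Lemma dual_lyapunov_equation :
  dual_lyapunov_op A N gamma (mx_integral `[0, +oo[ Z) = - Z 0.
Proof.
have [c [a [a0 h]]] := decay.
apply/matrixP => i j; rewrite dual_lyapunov_opE [RHS]mxE.
set l0 := mxtens_index (i, j).
pose f t := \sum_l vec (Z t) 0 l * K l l0.
have fE t : f t = dual_lyapunov_op A N gamma (Z t) i j.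
  by rewrite dual_lyapunov_opE mxE.
have cf : continuous f.
  by apply: continuous_sumE => l t; apply: cvgM; [exact: cv|exact: cvg_cst].
have iv l : (@lebesgue_measure R).-integrable `[0, +oo[ (fun t => (vec (Z t) 0 l)%:E).
  by apply: (exp_dominated_integrable a0 (@cv l)) => t t0; exact: h.
have df (t : R) : 0 < t -> is_derive t 1 (fun s => Z s i j) (f t).
  by move=> t0; rewrite fE; exact: dZ.
have hf (t : R) : 0 <= t -> `|f t| <= (\sum_l c * `|K l l0|) * expR (- a * t).
  move=> t0; apply: le_trans (ler_norm_sum _ _ _) _.
  rewrite mulr_suml; apply: ler_sum => l _.
  by rewrite normrM mulrAC ler_wpM2r // h.
have hZ (t : R) : 0 <= t -> `|Z t i j| <= c * expR (- a * t).
  by move=> t0; rewrite -vecE h.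
rewrite -(exp_dominated_FTC2y a0 a0 cf (@cZ i j) df hf hZ).
rewrite Rintegral_sumE //; last first.
  by move=> l; apply: (integrableZr _ (K l l0) (iv l)).
rewrite mxE; apply: eq_bigr => l _; rewrite RintegralZr //; last exact: iv.
congr (_ * _).
by rewrite !mxE; apply: eq_Rintegral => t _; rewrite mxE.
Qed.

End dual_lyapunov.

(** * Positivity of the dual Lyapunov flow *)

Definition qform (R : realType) (n : nat) (M : 'M[R]_n) (x : 'rV[R]_n) : R :=
  (x *m M *m x^T) 0 0.

Section quadratic_forms.
Variables (R : realType) (n : nat).
Implicit Types (M : 'M[R]_n) (x y : 'rV[R]_n).

Lemma qformE M x : qform M x = \sum_i \sum_j x 0 i * M i j * x 0 j.
Proof.
rewrite /qform mxE exchange_big /=; apply: eq_bigr => j _.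
by rewrite !mxE mulr_suml.
Qed.

Lemma qformD M1 M2 x : qform (M1 + M2) x = qform M1 x + qform M2 x.
Proof. by rewrite /qform mulmxDr mulmxDl mxE. Qed.

Lemma qformZ a M x : qform (a *: M) x = a * qform M x.
Proof. by rewrite /qform -scalemxAr -scalemxAl mxE. Qed.

Lemma qform_sum (I : finType) (M : I -> 'M[R]_n) x :
  qform (\sum_k M k) x = \sum_k qform (M k) x.
Proof. by rewrite /qform mulmx_sumr mulmx_suml summxE. Qed.

Lemma qform_tr M x : qform M^T x = qform M x.
Proof.
rewrite /qform (_ : x *m M^T *m x^T = (x *m M *m x^T)^T) ?mxE //.
by rewrite !trmx_mul trmxK mulmxA.
Qed.

Lemma qformZv a M x : qform M (a *: x) = a ^+ 2 * qform M x.
Proof.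
by rewrite /qform linearZ /= -!scalemxAl -scalemxAr scalerA mxE expr2.
Qed.

Lemma qform_mulmx p (B : 'M[R]_(n, p)) (M : 'M[R]_p) x :
  qform M (x *m B) = qform (B *m M *m B^T) x.
Proof. by rewrite /qform trmx_mul !mulmxA. Qed.

Lemma qform1 x : qform 1%:M x = \sum_i x 0 i ^+ 2.
Proof. by rewrite /qform mulmx1 mxE; apply: eq_bigr => i _; rewrite mxE expr2. Qed.

Lemma qform1_ge0 x : 0 <= qform 1%:M x.
Proof. by rewrite qform1 sumr_ge0 // => i _; rewrite sqr_ge0. Qed.

Lemma qform1_eq0 x : qform 1%:M x = 0 -> x = 0.
Proof.
rewrite qform1 => /eqP; rewrite psumr_eq0 => [/allP h|i _]; last exact: sqr_ge0.
apply/rowP => i; rewrite mxE; apply/eqP.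
by have := h i (mem_index_enum _); rewrite sqrf_eq0.
Qed.

(** With [z = x M], the form at [x + r z] is [2 r |z|^2 + r^2 c]; this is negative for small [r < 0]
    unless [z = 0]. *)
Lemma qform_isotropic M x : M^T = M -> (forall y, 0 <= qform M y) ->
  qform M x = 0 -> x *m M = 0.
Proof.
move=> Msym Mge0 Mx; apply: qform1_eq0.
set z := x *m M; set b := qform 1%:M z; set c := qform M z.
have expand (r : R) : qform M (x + r *: z) = 2 * r * b + r ^+ 2 * c.
  have zM : (z *m M *m x^T) 0 0 = b.
    rewrite /b /qform mulmx1 (_ : z *m M *m x^T = (z *m z^T)^T) ?mxE //.
    by rewrite trmx_mul trmxK /z trmx_mul Msym mulmxA.
  have xM : (x *m M *m z^T) 0 0 = b by rewrite /b /qform mulmx1.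
  rewrite /qform linearD linearZ /= !mulmxDl !mulmxDr -!scalemxAl -!scalemxAr.
  have addE (u v : 'M[R]_1) : (u + v) 0 0 = u 0 0 + v 0 0 by rewrite mxE.
  have scaE (a : R) (u : 'M[R]_1) : (a *: u) 0 0 = a * u 0 0 by rewrite mxE.
  by rewrite !addE !scaE zM xM -!/(qform _ _) Mx -/c; ring.
have c0 : 0 <= c := Mge0 z.
have c1 : 0 < c + 1 by rewrite ltr_wpDl.
(* The minimiser would be [r = - b / c]; replacing [c] by [c + 1] covers [c = 0] and still gives a
   negative multiple of [b ^+ 2]. *)
have := Mge0 (x + (- b / (c + 1)) *: z); rewrite expand.
rewrite [X in 0 <= X](_ : _ = - (b ^+ 2 * ((c + 2) / (c + 1) ^+ 2))); last first.
  by field; rewrite gt_eqF.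
rewrite oppr_ge0 pmulr_lle0; last by rewrite divr_gt0 ?exprn_gt0 // ltr_wpDl.
by move=> b2; apply/eqP; rewrite -sqrf_eq0 eq_le b2 sqr_ge0.
Qed.

End quadratic_forms.

Lemma continuous_qform (R : realType) (n : nat) (T : topologicalType)
    (S : T -> 'M[R]_n) (x : T -> 'rV[R]_n) :
  (forall i j, continuous (fun t => S t i j)) -> continuous x ->
  continuous (fun t => qform (S t) (x t)).
Proof.
move=> cS cx; rewrite (_ : (fun t => _) =
    fun t => \sum_i \sum_j x t 0 i * S t i j * x t 0 j); last first.
  by apply/funext => t; rewrite qformE.
have cxi i : continuous (fun t => x t 0 i).
  by move=> t; apply: (@continuous_comp _ _ _ x (fun v => v 0 i) t (cx t));
    exact: coord_continuous.
apply: continuous_sumE => i; apply: continuous_sumE => j t.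
by apply: cvgM; [apply: cvgM; [exact: cxi|exact: cS]|exact: cxi].
Qed.

Lemma is_derive_qform (R : realType) (n : nat) (S : R -> 'M[R]_n) (dS : 'M[R]_n)
    (t : R) (x : 'rV[R]_n) :
  (forall i j, is_derive t 1 (fun s => S s i j) (dS i j)) ->
  is_derive t 1 (fun s => qform (S s) x) (qform dS x).
Proof.
move=> h; rewrite qformE (_ : (fun s => _) =
    fun s => \sum_i \sum_j x 0 i * S s i j * x 0 j); last first.
  by apply/funext => s; rewrite qformE.
apply: is_derive_sumE => i; apply: is_derive_sumE => j; have ? := h i j.
by apply: is_derive_eq; rewrite /GRing.scale /=; ring.
Qed.

Lemma compact_sphere (R : realType) (n : nat) :
  compact [set x : 'rV[R]_n | qform 1%:M x = 1].
Proof.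
have Bco : compact [set x : 'rV[R]_n | forall i, x ord0 i \in `[(-1), 1]].
  apply: (@rV_compact R n (fun=> `[(-1 : R), 1]%classic)) => i.
  exact: segment_compact.
have Scl : closed [set x : 'rV[R]_n | qform 1%:M x = 1].
  apply: (@closed_comp _ _ (qform 1%:M) [set (1 : R)]); last exact: closed_eq.
  move=> x _; apply: (@continuous_qform _ _ _ (fun=> 1%:M) id).
    by move=> i j; exact: cst_continuous.
  by move=> y; exact: cvg_id.
apply: subclosed_compact Scl Bco _ => x /= x1 i.
rewrite in_itv /= -ler_norml -(@ler_pXn2r _ 2) ?nnegrE //.
rewrite expr1n -normrX ger0_norm ?sqr_ge0 // -x1 qform1 (bigD1 i) //=.
by rewrite lerDl sumr_ge0 // => j _; rewrite sqr_ge0.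
Qed.

(** The minimum in [dual_flow_psd] may sit at the right end of the time interval, so it has to be
    contradicted by an earlier time. *)
Lemma gt0_derive_lt_left (R : realType) (f : R -> R) (t d : R) :
  0 < t -> is_derive t 1 f d -> 0 < d -> exists2 s : R, 0 < s < t & f s < f t.
Proof.
move=> t0 [df <-] d0.
have /cvgr_gt/(_ 0 d0) : h^-1 *: ((f \o shift t) (h *: (1 : R)) - f t) @[h --> 0^']
    --> 'D_1 f t by exact: df.
move=> /nbhs_ballP[e /= e0 he].
pose h := - (Num.min e t / 2).
have [m0 me mt] : [/\ 0 < Num.min e t, Num.min e t <= e & Num.min e t <= t].
  by rewrite lt_min e0 t0 !ge_min !lexx orbT.
exists (t + h); first by rewrite /h; apply/andP; split; lra.
have : 0 < h^-1 *: ((f \o shift t) (h *: (1 : R)) - f t).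
  apply: he; last by rewrite /h; lra.
  by rewrite /ball /= sub0r normrN ltr_norml /h; apply/andP; split; lra.
rewrite /GRing.scale /= mulr1 (addrC h) nmulr_rgt0 ?subr_lt0 // invr_lt0 /h.
lra.
Qed.

Section dual_flow_psd.
Variables (R : realType) (n m p : nat) (A : 'M[R]_n) (N : 'I_m -> 'M[R]_n).
Variables (C : 'M[R]_(p, n)) (gamma : R) (Z : R -> 'M[R]_n).
Hypothesis Z0 : Z 0 = C^T *m C.
Hypothesis cZ : forall i j, continuous (fun t => Z t i j).
Hypothesis dZ : forall t : R, 0 < t -> forall i j,
  is_derive t 1 (fun s => Z s i j) (dual_lyapunov_op A N gamma (Z t) i j).

Let L := dual_lyapunov_op A N gamma.

Let L_tr X : (L X)^T = L X^T.
Proof.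
rewrite /L /dual_lyapunov_op !linearD linearZ /= linear_sum /=.
rewrite !trmx_mul trmxK [X in X + _]addrC; congr (_ + _ *: _).
by apply: eq_bigr => k _; rewrite !trmx_mul trmxK mulmxA.
Qed.

Let L_add X Y : L (X + Y) = L X + L Y.
Proof.
rewrite /L /dual_lyapunov_op mulmxDr mulmxDl.
under eq_bigr do rewrite mulmxDr mulmxDl.
rewrite big_split scalerDr /= [RHS]addrACA; congr (_ + _).
exact: addrACA.
Qed.

(** [Z] is not known to be symmetric, but only a symmetric matrix has an eigenvector at each minimum
    of its form on the sphere. [S] has twice the form of [Z] and follows the same flow, because [L]
    commutes with transposition. *)
Let S t := Z t + (Z t)^T.
Let sphere : set 'rV[R]_n := [set x | qform 1%:M x = 1].

(* [qform G] bounds the decay rate of the negative part of the flow. *)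
Let G := A + A + (gamma ^+ 2)^-1 *: \sum_k (N k)^T *m N k.

Let G_bounded x0 : sphere x0 -> exists c, forall x, sphere x -> qform G x <= c.
Proof.
move=> Sx0; have cG : continuous (qform G : 'rV[R]_n -> R).
  apply: (@continuous_qform _ _ _ (fun=> G) id).
    by move=> i j; exact: cst_continuous.
  by move=> y; exact: cvg_id.
have [||c _ hc] := @EVT_max_rV R n (qform G) sphere _ (@compact_sphere R n).
- by exists x0.
- exact: continuous_subspaceT.
- by exists (qform G c) => x Sx; apply: hc; rewrite inE.
Qed.

(** In the application [- a] is the least eigenvalue of [X], attained at [x]. The two drift terms
    are then known exactly, whereas the [N_k] terms evaluate [X] at [x (N_k)^T] and are only bounded
    below. *)
Let qform_L X x (a : R) : x *m X = - a *: x -> X^T = X ->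
  (forall y, - a * qform 1%:M y <= qform X y) ->
  - a * qform G x <= qform (L X) x.
Proof.
move=> xX Xsym Xge; have g0 : 0 <= (gamma ^+ 2)^-1 by rewrite invr_ge0 sqr_ge0.
have E1 : qform (X *m A) x = - a * qform A x.
  by rewrite /qform mulmxA xX -!scalemxAl mxE.
have E2 : qform (A^T *m X) x = - a * qform A x.
  by rewrite -E1 -qform_tr trmx_mul trmxK Xsym.
rewrite /L /dual_lyapunov_op /G !qformD !qformZ !qform_sum E1 E2.
rewrite mulrDr mulrDr lerD2l mulrCA ler_wpM2l // mulr_sumr.
apply: ler_sum => k _; have := Xge (x *m (N k)^T).
by rewrite !qform_mulmx trmxK mulmx1.
Qed.

(* At a negative minimum of [exp(- c t) x^T S(t) x] over [0, T] and the unit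
   sphere, [x] is an eigenvector of [S(t)]; for large [c] the time derivative
   there is positive, which is impossible. *)
Lemma dual_flow_psd (t : R) (x : 'rV[R]_n) : 0 <= t -> 0 <= qform (Z t) x.
Proof.
move=> t0; rewrite leNgt; apply/negP => neg.
have SE s y : qform (S s) y = 2 * qform (Z s) y.
  by rewrite /S qformD qform_tr; ring.
have x_neq0 : qform 1%:M x != 0.
  apply/eqP => /qform1_eq0 x0; move: neg; rewrite x0 /qform !mul0mx mxE.
  by rewrite ltxx.
have x_gt0 : 0 < qform 1%:M x by rewrite lt_def x_neq0 qform1_ge0.
have normalize (y : 'rV[R]_n) : 0 < qform 1%:M y ->
    exists2 z, sphere z & forall M, qform M y = qform 1%:M y * qform M z.
  move=> y0; exists ((Num.sqrt (qform 1%:M y))^-1 *: y).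
    by rewrite /sphere /= qformZv exprVn sqr_sqrtr ?ltW // mulVf ?gt_eqF.
  by move=> M; rewrite qformZv exprVn sqr_sqrtr ?ltW // mulVKf ?gt_eqF.
have [x1 Sx1 Ex1] := normalize x x_gt0.
have [c hc] := G_bounded Sx1.
(* Since [c] bounds [qform G] on the sphere, the rate [c + 1] leaves a surplus [a > 0] in the time
   derivative, which makes it strictly positive. *)
pose h (sy : R * 'rV[R]_n) := qform (expR (- (c + 1) * sy.1) *: S sy.1) sy.2.
have cS i j : continuous (fun s => S s i j).
  rewrite (_ : (fun s => S s i j) = fun s => Z s i j + Z s j i).
    by move=> s; apply: cvgD; exact: cZ.
  by apply/funext => s; rewrite !mxE.
have ch : continuous h.
  apply: (@continuous_qform R n _ (fun sy : R * 'rV[R]_n =>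
    expR (- (c + 1) * sy.1) *: S sy.1) snd); last by move=> ?; exact: cvg_snd.
  move=> i j; rewrite (_ : (fun sy => _) =
      (fun s : R => expR (- (c + 1) * s) * S s i j) \o fst).
    move=> sy; apply: continuous_comp; first exact: cvg_fst.
    by apply: cvgM; [exact: continuous_expRM|exact: cS].
  by apply/funext => sy; rewrite mxE.
have [||[s y] /= + hmin] := @compact_EVT_min _ _ h (`[0, t] `*` sphere) _
    (compact_setX (@segment_compact _ _ _) (@compact_sphere R n)).
- by exists (t, x1); split=> //=; rewrite in_itv /= t0 lexx.
- exact: continuous_subspaceT.
rewrite inE => -[/=]; rewrite in_itv /= => /andP[s0 st] Sy.
have hE r z : h (r, z) = expR (- (c + 1) * r) * qform (S r) z by rewrite /h qformZ.
have hneg : h (s, y) < 0.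
  apply: le_lt_trans (hmin (t, x1) _) _.
    by rewrite inE; split=> //=; rewrite in_itv /= t0 lexx.
  rewrite hE pmulr_rlt0 ?expR_gt0 // SE pmulr_rlt0 //.
  by move: neg; rewrite (Ex1 (Z t)) pmulr_rlt0.
pose a := - qform (S s) y.
have a0 : 0 < a by move: hneg; rewrite hE pmulr_rlt0 ?expR_gt0 // oppr_gt0.
have Ssym : (S s)^T = S s by rewrite /S linearD /= trmxK addrC.
have Sge z : - a * qform 1%:M z <= qform (S s) z.
  have [z0|z0] := eqVneq (qform 1%:M z) 0.
    by rewrite z0 mulr0 (qform1_eq0 z0) /qform !mul0mx mxE.
  have {}z0 : 0 < qform 1%:M z by rewrite lt_def z0 qform1_ge0.
  have [z1 Sz1 Ez] := normalize z z0.
  rewrite (Ez (S s)) mulrC ler_pM2l // opprK.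
  have := hmin (s, z1); rewrite inE !hE ler_pM2l ?expR_gt0 //; apply.
  by split=> //=; rewrite in_itv /= s0.
have Sy1 : qform 1%:M y = 1 := Sy.
(* [S s + a I] is positive semidefinite, by minimality of [y] on the sphere at time [s], and its
   form vanishes at [y]. *)
have yS : y *m S s = - a *: y.
  apply/eqP; rewrite scaleNr -addr_eq0 -mul_mx_scalar -mulmxDr; apply/eqP.
  have aE : a%:M = a *: 1%:M :> 'M[R]_n by rewrite scalemx1.
  apply: qform_isotropic.
  - by rewrite linearD /= Ssym tr_scalar_mx.
  - by move=> z; rewrite qformD aE qformZ -lerBlDr sub0r -mulNr.
  - by rewrite qformD aE qformZ Sy1 mulr1 /a subrr.
(* At time zero the form of [S] is [2 |C y|^2 >= 0]; the negative minimum therefore occurs at a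
   positive time, where the differential equation is available. *)
have s_gt0 : 0 < s.
  rewrite lt_def s0 andbT; apply/eqP => s00.
  move: a0; rewrite /a s00 SE Z0 oppr_gt0 pmulr_rlt0 // ltNge.
  by have := qform1_ge0 (y *m C^T); rewrite qform_mulmx trmxK mulmx1 => ->.
have dS i j : is_derive s 1 (fun r => (expR (- (c + 1) * r) *: S r) i j)
    ((expR (- (c + 1) * s) *: (- (c + 1) *: S s + L (S s))) i j).
  have ? := dZ s_gt0 i j; have ? := dZ s_gt0 j i.
  have ? := is_derive_expRM (- (c + 1)) s.
  rewrite (_ : (fun r => _) = fun r => expR (- (c + 1) * r) * (Z r i j + Z r j i)).
    apply: is_derive_eq.
    rewrite /S L_add -L_tr !mxE /GRing.scale /= -/(L _).
    ring.
  by apply/funext => r; rewrite !mxE.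
have dh : is_derive s 1 (fun r => h (r, y))
    (qform (expR (- (c + 1) * s) *: (- (c + 1) *: S s + L (S s))) y).
  exact: is_derive_qform.
have [|r /andP[r0 rs] hr] := gt0_derive_lt_left s_gt0 dh.
- rewrite qformZ pmulr_rgt0 ?expR_gt0 // qformD qformZ.
  apply: (@lt_le_trans _ _ (a * (c - qform G y) + a)).
    by rewrite ltr_wpDl // mulr_ge0 ?subr_ge0 ?hc // ltW.
  rewrite (_ : _ + a = - (c + 1) * qform (S s) y + - a * qform G y).
    by rewrite lerD2l; exact: qform_L yS Ssym Sge.
  by rewrite /a; ring.
- move: hr; apply/negP; rewrite -leNgt; apply: hmin; rewrite inE; split=> //=.
  by rewrite in_itv /= ltW //= (le_trans (ltW rs)).
Qed.

End dual_flow_psd.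

(** * Indefinite Lebesgue integrals and Gronwall's lemma *)

Section absolutely_continuous.
Variable R : realType.
Local Notation leb := (@lebesgue_measure R).

(** Replaces the monotonicity criterion by the sign of a derivative, since an indefinite Lebesgue
    integral is differentiable only almost everywhere. Estimates over steps of length [d / 2] are
    chained. *)
Lemma le_of_local_le (a b d : R) (U : R -> R) : 0 < d ->
  (forall s t, a <= s -> s <= t -> t <= b -> t - s < d -> U t <= U s) ->
  forall t, a <= t -> t <= b -> U t <= U a.
Proof.
move=> d0 hU; pose e := d / 2.
have e0 : 0 < e by rewrite divr_gt0.
have ed : e < d by rewrite /e; lra.
have step k : forall t, a <= t -> t <= b -> t - a <= e *+ k -> U t <= U a.
  elim: k => [|k IH] t at_ tb.
    by rewrite mulr0n subr_le0 => ta; have -> : t = a by apply/le_anti; rewrite ta.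
  rewrite mulrSr => htk; have [tae|tae] := leP (t - a) e.
    by apply: hU => //; exact: le_lt_trans tae ed.
  apply: (@le_trans _ _ (U (t - e))); first by apply: hU => //; lra.
  by apply: IH; lra.
move=> t at_ tb; apply: (step (Num.truncn ((t - a) / e)).+1) => //.
rewrite -mulr_natr mulrC -ler_pdivrMr //.
by apply/ltW/truncnS_gt.
Qed.

Lemma le_norm_of_local_le (a b d : R) (D H : R -> R) : 0 < d ->
  (forall s t, a <= s -> s <= t -> t <= b -> t - s < d ->
    `|D t - D s| <= H t - H s) ->
  forall t, a <= t -> t <= b -> `|D t - D a| <= H t - H a.
Proof.
move=> d0 loc t at_ tb.
have up : D t - H t <= D a - H a.
  apply: (le_of_local_le d0 _ at_ tb (U := fun r => D r - H r)) => s r as_ sr rb rs.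
  by have := loc s r as_ sr rb rs; rewrite ler_norml => /andP[? ?]; lra.
have dn : - D t - H t <= - D a - H a.
  apply: (le_of_local_le d0 _ at_ tb (U := fun r => - D r - H r)) => s r as_ sr rb rs.
  by have := loc s r as_ sr rb rs; rewrite ler_norml => /andP[? ?]; lra.
by rewrite ler_norml; apply/andP; split; lra.
Qed.

Lemma Rintegral_itv11 (f : R -> R) a : Rintegral leb `[a, a] f = 0.
Proof. by rewrite set_itv1 Rintegral_set1. Qed.

Section interval.
Variables a b : R.

(** Absolute continuity of [F] on [[a, b]] in integral form: [f] plays the part of the derivative
    but is given at every point, so inequalities between densities need no exceptional null set. *)
Definition primitive_of (f F : R -> R) : Prop :=
  leb.-integrable `[a, b] (EFin \o f) /\
  forall t, a <= t -> t <= b -> F t = F a + Rintegral leb `[a, t] f.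

Lemma integrable_sub_itv (f : R -> R) s t :
  leb.-integrable `[a, b] (EFin \o f) -> a <= s -> t <= b ->
  leb.-integrable `[s, t] (EFin \o f).
Proof.
move=> if_ as_ tb; apply: integrableS if_ => //.
by apply: subset_itv; rewrite bnd_simp.
Qed.

Lemma Rintegral_itv_cat (f : R -> R) s t :
  leb.-integrable `[a, b] (EFin \o f) -> a <= s -> s <= t -> t <= b ->
  Rintegral leb `[a, t] f = Rintegral leb `[a, s] f + Rintegral leb `[s, t] f.
Proof.
move=> if_ as_ st tb.
have iat : leb.-integrable `[a, t] (EFin \o f) by exact: integrable_sub_itv if_ _ _.
have := @Rintegral_itvB R f (BLeft a) (BRight t) s iat.
rewrite !bnd_simp => /(_ as_ st) /eqP; rewrite subr_eq addrC => /eqP ->.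
congr (_ + _); rewrite -Rintegral_itv_obnd_cbnd //.
by apply: integrableS iat => //; apply: subset_itv; rewrite bnd_simp.
Qed.

Lemma primitive_incr f F s t : primitive_of f F ->
  a <= s -> s <= t -> t <= b -> F t - F s = Rintegral leb `[s, t] f.
Proof.
move=> [if_ hF] as_ st tb.
rewrite hF ?(le_trans as_) // (hF s) ?(le_trans st) //.
by rewrite (Rintegral_itv_cat if_ as_ st tb); ring.
Qed.

Lemma small_Rintegral (f : R -> R) : leb.-integrable `[a, b] (EFin \o f) ->
  forall e, 0 < e -> exists d, 0 < d /\ forall s t, a <= s -> s <= t -> t <= b ->
    t - s < d -> Rintegral leb `[s, t] (fun v => `|f v|) < e.
Proof.
move=> if_ e e0.
have ifab : leb.-integrable setT (EFin \o (f \_ `[a, b])).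
  by rewrite -restrict_EFin; apply/integrable_restrict => //; rewrite setTI.
have [d [d0 hd]] := integral_normr_continuous ifab e0.
exists d; split=> // s t as_ st tb tsd.
have lst : (leb `[s, t] < d%:E)%E.
  by rewrite lebesgue_measure_itv /=; case: ifPn => _; rewrite -?EFinB lte_fin.
have := hd `[s, t]%classic (measurable_itv _) lst; congr (_ < _).
apply: eq_Rintegral => v; rewrite inE /= in_itv /= => /andP[sv vt].
by rewrite patchE mem_set //= in_itv /= (le_trans as_) // (le_trans vt).
Qed.

Hypothesis ab : a <= b.

Lemma primitive_continuous f F : primitive_of f F -> {within `[a, b], continuous F}.
Proof.
move=> [if_ hF].
have := parameterized_integral_continuous ab if_.
move=> h; apply: (@subspace_eq_continuous _ _ _
  (fun t => F a + Rintegral leb `[a, t] f)).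
  by move=> t; rewrite inE /= in_itv /= => /andP[at_ tb]; rewrite -hF.
by move=> t; apply: cvgD; [exact: cvg_cst|exact: h].
Qed.

Lemma within_continuous_integrableM (F f : R -> R) :
  {within `[a, b], continuous F} -> leb.-integrable `[a, b] (EFin \o f) ->
  leb.-integrable `[a, b] (fun v => (F v * f v)%:E).
Proof.
move=> cF if_; apply: (integrableMr _ _ _ if_) => //.
  exact: subspace_continuous_measurable_fun.
have /compact_bounded := continuous_compact cF (@segment_compact _ a b).
move=> [M [Mr hM]]; exists M; split => // y My x abx.
by apply: hM My _ _; exists x.
Qed.

Lemma primitiveD f F g G : primitive_of f F -> primitive_of g G ->
  primitive_of (fun v => f v + g v) (fun v => F v + G v).
Proof.
move=> [if_ hF] [ig hG]; split; first by have := integrableD _ if_ ig; apply.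
move=> t at_ tb; rewrite RintegralD //; try exact: integrable_sub_itv.
by rewrite hF // hG //; ring.
Qed.

Lemma primitiveZ c f F : primitive_of f F ->
  primitive_of (fun v => c * f v) (fun v => c * F v).
Proof.
move=> [if_ hF]; split; first by have := integrableZl _ c if_; apply.
move=> t at_ tb; rewrite RintegralZl //; last exact: integrable_sub_itv.
by rewrite hF // mulrDr.
Qed.

Lemma primitive_cst c : primitive_of (fun=> 0) (fun=> c).
Proof.
split; first exact: integrable0.
by move=> t _ _; rewrite Rintegral_cst //= mul0r addr0.
Qed.

Lemma primitive_sum (I : finType) (f F : I -> R -> R) :
  (forall i, primitive_of (f i) (F i)) ->
  primitive_of (fun v => \sum_i f i v) (fun v => \sum_i F i v).
Proof.
move=> h; rewrite -!fct_sumE.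
elim/big_ind2 : _ => [|f1 F1 f2 F2 h1 h2|i _]; last exact: h.
  exact: primitive_cst.
exact: primitiveD.
Qed.

Lemma primitive_Rintegral (f : R -> R) : leb.-integrable `[a, b] (EFin \o f) ->
  primitive_of f (fun t => Rintegral leb `[a, t] f).
Proof.
move=> if_; split=> // t _ _.
by rewrite Rintegral_itv11 add0r.
Qed.

Lemma primitive_incr_bound f F s t : primitive_of f F ->
  a <= s -> s <= t -> t <= b ->
  `|F t - F s| <= Rintegral leb `[s, t] (fun v => `|f v|).
Proof.
move=> pF as_ st tb; rewrite (primitive_incr pF) // le_normr_Rintegral //.
by apply: integrable_sub_itv as_ tb; case: pF.
Qed.

(* Over a short interval, the defect of the product rule is at most [e] times
   the variation of the two factors. *)
Lemma primitiveM f F g G : primitive_of f F -> primitive_of g G ->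
  primitive_of (fun v => f v * G v + F v * g v) (fun v => F v * G v).
Proof.
move=> pF pG; have [if_ hF] := pF; have [ig hG] := pG.
have iGf := within_continuous_integrableM (primitive_continuous pG) if_.
have iFg := within_continuous_integrableM (primitive_continuous pF) ig.
have ip : leb.-integrable `[a, b] (EFin \o (fun v => f v * G v + F v * g v)).
  rewrite (_ : _ \o _ = (fun v => (G v * f v)%:E) \+ (fun v => (F v * g v)%:E))%E.
    exact: integrableD.
  by apply/funext => v /=; rewrite EFinD (mulrC (f v)).
split=> // t at_ tb.
pose p v := f v * G v + F v * g v.
pose h v := `|f v| + `|g v|.
have ih : leb.-integrable `[a, b] (EFin \o h).
  have := integrableD _ (integrable_norm if_) (integrable_norm ig); exact.
pose D r := F r * G r - Rintegral leb `[a, r] p.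
suff bound e : 0 < e -> `|D t - D a| <= e * Rintegral leb `[a, t] h.
  have D0 : D t - D a = 0.
    apply/eqP; rewrite -normr_le0; apply/ler_addgt0Pr => e e0.
    rewrite add0r.
    have hp : 0 < Rintegral leb `[a, t] h + 1.
      by rewrite ltr_wpDl // Rintegral_ge0 // => v _; rewrite addr_ge0.
    apply: le_trans (bound (e / (Rintegral leb `[a, t] h + 1)) _) _.
      by rewrite divr_gt0.
    by rewrite mulrAC ler_pdivrMr // ler_pM2l // lerDl ler01.
  move/eqP: D0; rewrite subr_eq0 /D Rintegral_itv11 subr0.
  by rewrite subr_eq => /eqP.
move=> e0.
have [d1 [d10 hd1]] := small_Rintegral if_ e0.
have [d2 [d20 hd2]] := small_Rintegral ig e0.
have loc s r : a <= s -> s <= r -> r <= b -> r - s < Num.min d1 d2 ->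
    `|D r - D s| <= e * Rintegral leb `[s, r] h.
  move=> as_ sr rb; rewrite lt_min => /andP[rs1 rs2].
  have sub k : leb.-integrable `[a, b] (EFin \o k) ->
      leb.-integrable `[s, r] (EFin \o k) by move=> ik; exact: integrable_sub_itv.
  have i1 : leb.-integrable `[s, r] (EFin \o (fun v => f v * G r)).
    have := integrableZr _ (G r) (sub _ if_); exact.
  have i2 : leb.-integrable `[s, r] (EFin \o (fun v => F s * g v)).
    have := integrableZl _ (F s) (sub _ ig); exact.
  have i12 : leb.-integrable `[s, r] (EFin \o (fun v => f v * G r + F s * g v)).
    have := integrableD _ i1 i2; exact.
  (* The increment of [F G] is split as [(F r - F s) G r + F s (G r - G s)]. Compared with the
     density [p], the error then contains only the increments [G r - G v] and [F v - F s], both at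
     most [e] on a short interval. *)
  have -> : D r - D s = Rintegral leb `[s, r]
      (fun v => (f v * G r + F s * g v) - p v).
    rewrite RintegralB //; last exact: sub.
    rewrite RintegralD // RintegralZr ?RintegralZl //; try exact: sub.
    rewrite -(primitive_incr pF) // -(primitive_incr pG) //.
    by rewrite /D (Rintegral_itv_cat ip as_ sr rb); ring.
  have idef : leb.-integrable `[s, r]
      (EFin \o (fun v => (f v * G r + F s * g v) - p v)).
    have := integrableB _ i12 (sub _ ip); exact.
  apply: le_trans (le_normr_Rintegral _ idef) _ => //.
  rewrite -RintegralZl //; last exact: sub.
  apply: le_Rintegral => //.
  - exact: integrable_norm.
  - have := integrableZl _ e (sub _ ih); exact.
  move=> v; rewrite /= in_itv /= => /andP[sv vr].
  have -> : f v * G r + F s * g v - p v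
      = f v * (G r - G v) - (F v - F s) * g v by rewrite /p; ring.
  apply: le_trans (ler_normB _ _) _; rewrite !normrM mulrDr; apply: lerD.
    rewrite mulrC ler_wpM2r // ltW //.
    apply: le_lt_trans (primitive_incr_bound pG _ vr rb) (hd2 v r _ vr rb _).
    - exact: le_trans sv.
    - exact: le_trans sv.
    - by rewrite (le_lt_trans _ rs2) // lerD2l lerN2.
  rewrite ler_wpM2r // ltW //.
  have vb : v <= b by exact: le_trans rb.
  apply: le_lt_trans (primitive_incr_bound pF as_ sv vb) (hd1 s v as_ sv vb _).
  by rewrite (le_lt_trans _ rs1) // lerD2r.
have m0 : 0 < Num.min d1 d2 by rewrite lt_min d10.
pose H r := e * Rintegral leb `[a, r] h.
have Ha : H a = 0 by rewrite /H Rintegral_itv11 mulr0.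
have := le_norm_of_local_le m0 _ at_ tb (D := D) (H := H).
rewrite Ha subr0; apply=> s r as_ sr rb rs.
apply: le_trans (loc s r as_ sr rb rs) _.
by rewrite /H (Rintegral_itv_cat ih as_ sr rb) mulrDr addrAC subrr add0r.
Qed.

End interval.

End absolutely_continuous.

(** * Gronwall's lemma with an integrable rate *)

Section gronwall.
Variables (R : realType) (a b : R).
Hypothesis ab : a <= b.
Local Notation leb := (@lebesgue_measure R).
Variables beta f F : R -> R.
Hypothesis ibeta : leb.-integrable `[a, b] (EFin \o beta).
Hypothesis beta_ge0 : forall v, a <= v -> v <= b -> 0 <= beta v.
Hypothesis pF : primitive_of a b f F.
Hypothesis F_ge0 : forall v, a <= v -> v <= b -> 0 <= F v.
Hypothesis fle : forall v, a <= v -> v <= b -> f v <= F v * beta v.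

(* [G = F a + int beta F] dominates [F], and [G t (1 - int_s^t beta) <= G s];
   for [k > 1] this makes [G exp(- k int beta)] locally nonincreasing. *)
Let gronwall_gt1 k : 1 < k -> F b <= F a * expR (k * Rintegral leb `[a, b] beta).
Proof.
move=> k1; have k0 : 0 < k by exact: lt_trans k1.
have iFb := within_continuous_integrableM (primitive_continuous ab pF) ibeta.
pose G t := F a + Rintegral leb `[a, t] (fun v => F v * beta v).
have pG : primitive_of a b (fun v => F v * beta v) G.
  split=> // t _ _; by rewrite /G Rintegral_itv11 addr0.
have Ga : G a = F a by rewrite /G Rintegral_itv11 addr0.
have FG t : a <= t -> t <= b -> F t <= G t.
  move=> at_ tb; have [if_ ->] := pF => //; rewrite /G lerD2l.
  apply: le_Rintegral => //.
  - exact: integrable_sub_itv if_ _ tb.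
  - exact: integrable_sub_itv iFb _ tb.
  by move=> v; rewrite /= in_itv /= => /andP[av vt]; apply: fle => //; exact: le_trans tb.
have Gincr s t : a <= s -> s <= t -> t <= b -> G s <= G t.
  move=> as_ st tb; rewrite -subr_ge0 (primitive_incr pG) // Rintegral_ge0 //.
  move=> v; rewrite /= in_itv /= => /andP[sv vt].
  by rewrite mulr_ge0 ?F_ge0 ?beta_ge0 ?(le_trans as_) // (le_trans vt).
have G_ge0 t : a <= t -> t <= b -> 0 <= G t.
  by move=> at_ tb; rewrite (le_trans (F_ge0 at_ tb)) // FG.
pose B t := Rintegral leb `[a, t] beta.
(* For [0 <= De] below this threshold [(1 + k De) (1 - De) >= 1], whence
   [expR (- k De) <= (1 + k De)^-1 <= 1 - De]. *)
have e0 : 0 < (k - 1) / k by rewrite divr_gt0 // subr_gt0.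
have [d [d0 hd]] := small_Rintegral ibeta e0.
have loc s t : a <= s -> s <= t -> t <= b -> t - s < d ->
    G t * expR (- k * B t) <= G s * expR (- k * B s).
  move=> as_ st tb tsd; pose De := Rintegral leb `[s, t] beta.
  have Bt : B t = B s + De by exact: (Rintegral_itv_cat ibeta as_ st tb).
  have ist : leb.-integrable `[s, t] (EFin \o beta) by exact: (integrable_sub_itv ibeta as_ tb).
  have De0 : 0 <= De.
    apply: Rintegral_ge0 => v; rewrite /= in_itv /= => /andP[sv vt].
    by rewrite beta_ge0 ?(le_trans as_) // (le_trans vt).
  have Ded : De < (k - 1) / k.
    apply: le_lt_trans (hd s t as_ st tb tsd).
    apply: le_Rintegral => //; first exact: (integrable_norm ist).
    by move=> v _; exact: ler_norm.
  have GDe : G t * (1 - De) <= G s.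
    rewrite mulrBr mulr1 lerBlDr -lerBlDl (primitive_incr pG) //.
    rewrite -RintegralZl //; apply: le_Rintegral => //.
    - exact: integrable_sub_itv iFb as_ tb.
    - have := integrableZl _ (G t) ist; exact.
    move=> v; rewrite /= in_itv /= => /andP[sv vt].
    have av : a <= v by exact: le_trans sv.
    have vb : v <= b by exact: le_trans tb.
    by rewrite ler_wpM2r ?beta_ge0 // (le_trans (FG v av vb)) // Gincr.
  rewrite Bt mulrDr expRD (mulrC (expR _)) mulrA.
  apply: (@le_trans _ _ ((G t * (1 - De)) * expR (- k * B s))); last first.
    by rewrite ler_wpM2r ?expR_ge0.
  rewrite ler_wpM2r ?expR_ge0 // ler_wpM2l ?G_ge0 ?(le_trans as_) //.
  have kD0 : 0 < 1 + k * De by rewrite ltr_wpDr // mulr_ge0 // ltW.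
  rewrite mulNr expRN; apply: (@le_trans _ _ (1 + k * De)^-1).
    by rewrite lef_pV2 ?posrE ?expR_gt0 // expR_ge1Dx.
  rewrite -[(1 + k * De)^-1]mul1r ler_pdivrMr //.
  move: Ded; rewrite ltr_pdivlMr // => Ded.
  rewrite -subr_ge0 [leRHS](_ : _ = De * (k - 1 - De * k)); last by ring.
  by rewrite mulr_ge0 // subr_ge0 ltW.
have := le_of_local_le d0 loc ab (lexx b).
rewrite {2}/B Rintegral_itv11 mulr0 expR0 mulr1 Ga => hb.
apply: le_trans (FG b ab (lexx b)) _.
rewrite -[leLHS]mulr1 -(expRxMexpNx_1 (k * B b)) mulrCA mulrC -mulNr.
by rewrite ler_wpM2r ?expR_ge0.
Qed.

(** The bound [expR (- k De) <= 1 - De] fails at [k = 1] for every [De > 0], so the sharp exponent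
    is reached only as the limit of the inequality as [k] decreases to 1. *)
Lemma gronwall : F b <= F a * expR (Rintegral leb `[a, b] beta).
Proof.
set I := Rintegral _ _ _.
have cE : continuous (fun k : R => F a * expR (k * I)).
  under eq_fun do rewrite mulrC [_ * I]mulrC.
  by move=> k; apply: cvgM; [exact: continuous_expRM|exact: cvg_cst].
have h : F a * expR (k * I) @[k --> 1^'+] --> F a * expR (1 * I).
  by apply: cvg_at_right_filter; exact: cE.
rewrite -[X in expR X]mul1r -(cvg_lim _ h) //; apply: limr_ge.
  by apply/cvg_ex; exists (F a * expR (1 * I)).
near=> k; apply: gronwall_gt1; near: k; exact: nbhs_right_gt.
Unshelve. all: by end_near. Qed.

End gronwall.

(** * The Gramian and the trajectories *)

Lemma continuous_max0_extension (R : realType) (f : R -> R) :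
  {within `[0, +oo[, continuous f} -> continuous (fun t : R => f (Num.max t 0)).
Proof.
move=> cf t.
have mt : `[0%R, +oo[%classic (Num.max t 0).
  by rewrite /= in_itv /= andbT le_max lexx orbT.
have h : f @ within `[0%R, +oo[%classic (nbhs (Num.max t 0)) --> f (Num.max t 0).
  by rewrite nbhs_subspace_in //; exact: cf.
have mc : {for t, continuous (fun s : R => Num.max s 0)}.
  by apply: (@continuous_max _ _ id (cst 0)); [exact: cvg_id|exact: cvg_cst].
move=> U /h hU; apply: (@filterS _ (nbhs t) _ _ _ _ (mc _ hU)) => s /=; apply.
by rewrite /= in_itv /= andbT le_max lexx orbT.
Qed.

Section gramian.
Variables (R : realType) (n m p : nat) (A : 'M[R]_n) (N : 'I_m -> 'M[R]_n).
Variables (C : 'M[R]_(p, n)) (gamma : R) (Z : R -> 'M[R]_n).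
Hypothesis hZ : dual_lyapunov_flow A N C gamma Z.
Hypothesis hK : hurwitz (tensmx A (1%:M : 'M[R]_n)
  + tensmx (1%:M : 'M[R]_n) A + (gamma ^+ 2)^-1 *: \sum_k tensmx (N k) (N k)).

(** Freezing [Z] at its initial value for negative times gives a flow that is continuous on the
    whole line, as the decay and positivity results assume; the Gramian only sees [[0, +oo[]. *)
Let Y (t : R) := Z (Num.max t 0).

Let YE t : 0 <= t -> Y t = Z t.
Proof. by move=> t0; rewrite /Y; congr Z; apply/max_idPl. Qed.

Let Y0 : Y 0 = C^T *m C.
Proof. by case: hZ => Z0 _ _; rewrite YE. Qed.

Let cY i j : continuous (fun t : R => Y t i j).
Proof. by case: hZ => _ cZ _; exact: (continuous_max0_extension (@cZ i j)). Qed.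

Let dY (t : R) : 0 < t -> forall i j,
  is_derive t 1 (fun s => Y s i j) (dual_lyapunov_op A N gamma (Y t) i j).
Proof.
move=> t0 i j; case: hZ => _ _ dZ; rewrite YE ?ltW //.
apply: near_eq_is_derive (dZ t t0 i j).
near=> s; rewrite YE // ltW //; near: s; exact: lt_nbhsr.
Unshelve. all: by end_near. Qed.

Let mx_integralE : mx_integral `[0, +oo[ Y = mx_integral `[0, +oo[ Z.
Proof.
apply/matrixP => i j; rewrite !mxE; apply: eq_Rintegral => t.
by rewrite inE /= in_itv /= andbT => t0; rewrite YE.
Qed.

Lemma gramian_lyapunov_equation :
  dual_lyapunov_op A N gamma (mx_integral `[0, +oo[ Z) = - (C^T *m C).
Proof. by rewrite -mx_integralE (dual_lyapunov_equation cY dY hK) Y0. Qed.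

Lemma gramian_psd (x : 'rV[R]_n) : 0 <= qform (mx_integral `[0, +oo[ Z) x.
Proof.
rewrite -mx_integralE.
have iY i j : (@lebesgue_measure R).-integrable `[0, +oo[
    (EFin \o (fun t => x 0 i * Y t i j * x 0 j)).
  have := integrableZl _ (x 0 i * x 0 j) (dual_flow_integrable cY dY hK i j).
  move=> /(_ (measurable_itv _)); congr (_.-integrable _ _).
  by apply/funext => t /=; rewrite -EFinM; congr EFin; ring.
rewrite (_ : qform _ x = Rintegral (@lebesgue_measure R) `[0, +oo[
    (fun t => qform (Y t) x)).
  apply: Rintegral_ge0 => t; rewrite /= in_itv /= andbT => t0.
  exact: (dual_flow_psd Y0 cY dY).
under [RHS]eq_Rintegral do rewrite qformE.
rewrite Rintegral_sumE //; last first.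
  by move=> i; apply: (integrable_sumE _ (fun j => iY i j)).
rewrite qformE; apply: eq_bigr => i _.
rewrite Rintegral_sumE //; apply: eq_bigr => j _.
have iYij := dual_flow_integrable cY dY hK i j.
rewrite RintegralZr // ?RintegralZl ?mxE //.
have := integrableZl _ (x 0 i) iYij; exact.
Qed.

End gramian.

Section trajectory.
Variables (R : realType) (n m p : nat) (A : 'M[R]_n) (N : 'I_m -> 'M[R]_n).
Variables (u : R -> 'cV[R]_m) (Phi : R -> R -> 'M[R]_n) (v : 'cV[R]_n).
Hypothesis hPhi : fundamental_solution A N u Phi.
Variables (t0 T : R).
Hypotheses (t0_ge0 : 0 <= t0) (t0T : t0 <= T).
Local Notation leb := (@lebesgue_measure R).

Lemma fundamental_solution_id : Phi t0 t0 = 1%:M.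
Proof.
have [_ _ ->] := hPhi t0_ge0 (lexx t0).
have int0 (F : R -> 'M[R]_n) : mx_integral `[t0, t0] F = 0.
  by apply/matrixP => i j; rewrite !mxE Rintegral_itv11.
by rewrite int0 big1 ?addr0.
Qed.

Let x t : 'rV[R]_n := (Phi t t0 *m v)^T.
(** The right-hand side of the state equation, serving as the density of [x]; pointwise
    differentiability of [x] is not claimed. *)
Let dx t : 'rV[R]_n := x t *m A^T + \sum_k u t k 0 *: (x t *m (N k)^T).

Lemma trajectory_primitive j :
  primitive_of t0 T (fun t => dx t 0 j) (fun t => x t 0 j).
Proof.
have pPhi l : primitive_of t0 T (fun t => (A *m Phi t t0) j l
    + \sum_k (u t k 0 *: (N k *m Phi t t0)) j l) (fun t => Phi t t0 j l).
  have [iA iN _] := hPhi t0_ge0 t0T.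
  have iS : leb.-integrable `[t0, T] (EFin \o
      (fun t => \sum_k (u t k 0 *: (N k *m Phi t t0)) j l)).
    by apply: integrable_sumE => // k; exact: iN.
  split; first by have := integrableD _ (iA j l) iS; apply.
  move=> t at_ tT.
  have sub (f : R -> R) : leb.-integrable `[t0, T] (EFin \o f) ->
      leb.-integrable `[t0, t] (EFin \o f).
    by move=> if_; exact: integrable_sub_itv if_ _ tT.
  have [_ _ ->] := hPhi t0_ge0 at_.
  rewrite fundamental_solution_id (RintegralD _ (sub _ (iA j l)) (sub _ iS)) //.
  rewrite Rintegral_sumE //; last by move=> k; apply: sub; exact: iN.
  rewrite mxE [X in X + _]mxE [X in _ + X + _]mxE summxE addrA.
  by congr (_ + _); apply: eq_bigr => k _; rewrite mxE.
have := primitive_sum (fun l => primitiveZ (v l 0) (pPhi l)).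
congr primitive_of; apply/funext => t.
  have xM (B : 'M[R]_n) :
      (x t *m B^T) 0 j = \sum_l v l 0 * (B *m Phi t t0) j l.
    rewrite /x -trmx_mul mxE mulmxA mxE.
    by apply: eq_bigr => l _; rewrite mulrC.
  have -> : dx t 0 j = (x t *m A^T) 0 j
      + \sum_k u t k 0 * (x t *m (N k)^T) 0 j.
    rewrite /dx [LHS]mxE summxE; congr (_ + _).
    by apply: eq_bigr => k _; rewrite [LHS]mxE.
  rewrite xM [X in _ = _ + X](eq_bigr (fun k =>
    \sum_l u t k 0 * (v l 0 * (N k *m Phi t t0) j l))); last first.
    by move=> k _; rewrite xM mulr_sumr.
  rewrite exchange_big /= -big_split /=; apply: eq_bigr => l _.
  rewrite mulrDr mulr_sumr; congr (_ + _).
  by apply: eq_bigr => k _; rewrite mxE mulrCA.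
by rewrite /x mxE mxE; apply: eq_bigr => l _; rewrite mulrC.
Qed.

Lemma trajectory_qform_primitive (M : 'M[R]_n) :
  primitive_of t0 T
    (fun t => (dx t *m M *m (x t)^T) 0 0 + (x t *m M *m (dx t)^T) 0 0)
    (fun t => qform M (x t)).
Proof.
have pE i j := primitiveZ (M i j)
  (primitiveM t0T (trajectory_primitive i) (trajectory_primitive j)).
have := primitive_sum (fun i => primitive_sum (fun j => pE i j)).
congr primitive_of; apply/funext => t.
  have bE (y z : 'rV[R]_n) : (y *m M *m z^T) 0 0
      = \sum_i \sum_j y 0 i * M i j * z 0 j.
    rewrite mxE exchange_big /=; apply: eq_bigr => j _.
    by rewrite !mxE mulr_suml.
  rewrite !bE -big_split /=; apply: eq_bigr => i _.
  rewrite -big_split /=; apply: eq_bigr => j _; ring.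
rewrite qformE; apply: eq_bigr => i _; apply: eq_bigr => j _; ring.
Qed.

Lemma trajectory_qform_continuous (M : 'M[R]_n) :
  {within `[t0, T], continuous (fun t => qform M (x t))}.
Proof. exact: primitive_continuous (trajectory_qform_primitive M). Qed.

End trajectory.

(** * The energy estimate *)

(* Young's inequality in the seminorm of [Q]: expand
   [0 <= qform Q (gamma u_k x - gamma^-1 N_k x)]. *)
Lemma lyapunov_dissipation (R : realType) (n m p : nat) (A Q : 'M[R]_n)
    (N : 'I_m -> 'M[R]_n) (C : 'M[R]_(p, n)) (gamma : R) (x dx : 'rV[R]_n)
    (w : 'I_m -> R) :
  0 < gamma -> (forall y, 0 <= qform Q y) ->
  dual_lyapunov_op A N gamma Q = - (C^T *m C) ->
  dx = x *m A^T + \sum_k w k *: (x *m (N k)^T) ->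
  (dx *m Q *m x^T) 0 0 + (x *m Q *m dx^T) 0 0 + qform (C^T *m C) x
    <= qform Q x * \sum_k (gamma * (if N k == 0 then 0 else w k)) ^+ 2.
Proof.
move=> g0 Qge0 LQ dxE; have gN0 : gamma != 0 by rewrite gt_eqF.
have addE (M1 M2 : 'M[R]_1) : (M1 + M2) 0 0 = M1 0 0 + M2 0 0 by rewrite mxE.
have scaE a (M : 'M[R]_1) : (a *: M) 0 0 = a * M 0 0 by rewrite mxE.
pose c k := (x *m (N k)^T *m Q *m x^T) 0 0 + (x *m Q *m (x *m (N k)^T)^T) 0 0.
have -> : (dx *m Q *m x^T) 0 0 + (x *m Q *m dx^T) 0 0
    = qform (A^T *m Q + Q *m A) x + \sum_k w k * c k.
  rewrite dxE linearD /= linear_sum /= !mulmxDl !mulmxDr !addE addrACA.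
  congr (_ + _); first by rewrite qformD /qform trmx_mul trmxK !mulmxA.
  rewrite !mulmx_suml mulmx_sumr !summxE -big_split /=; apply: eq_bigr => k _.
  by rewrite linearZ /= -!scalemxAl -!scalemxAr !scaE mulrDr.
have -> : qform (C^T *m C) x = - qform (A^T *m Q + Q *m A) x
    - (gamma ^+ 2)^-1 * \sum_k qform ((N k)^T *m Q *m N k) x.
  have -> : C^T *m C = - 1 *: dual_lyapunov_op A N gamma Q.
    by rewrite LQ scaleN1r opprK.
  by rewrite qformZ /dual_lyapunov_op qformD qformZ qform_sum; ring.
(* The drift terms cancel against those in [C^T C]; what remains splits into one inequality for each
   [k]. *)
rewrite addrACA subrr add0r lerBlDl mulr_sumr mulr_sumr.
rewrite -big_split; apply: ler_sum => k _ /=.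
have young a : a * c k <= (gamma ^+ 2)^-1 * qform ((N k)^T *m Q *m N k) x
    + qform Q x * (gamma * a) ^+ 2.
  have := Qge0 ((gamma * a) *: x - gamma^-1 *: (x *m (N k)^T)).
  have -> : qform Q ((gamma * a) *: x - gamma^-1 *: (x *m (N k)^T))
      = (gamma ^+ 2)^-1 * qform ((N k)^T *m Q *m N k) x
        + qform Q x * (gamma * a) ^+ 2 - a * c k.
    have -> : qform ((N k)^T *m Q *m N k) x = qform Q (x *m (N k)^T).
      by rewrite qform_mulmx trmxK.
    rewrite /c /qform -scaleNr linearD !linearZ /=.
    rewrite !mulmxDl !mulmxDr -!scalemxAl -!scalemxAr !addE !scaE.
    by rewrite /GRing.scale /=; field.
  by rewrite subr_ge0.
(* If [N k = 0], then [c k = 0] and the factor [w k] may be replaced by 0 before applying Young's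
   inequality: this is how [u^0] takes the place of [u]. *)
case: eqP => [Nk0|_]; last exact: young.
rewrite (_ : w k * c k = 0 * c k); first exact: young.
by rewrite mul0r /c Nk0 trmx0 mulmx0 !mul0mx trmx0 mulmx0 mxE addr0 mulr0.
Qed.

Lemma norm2_sqr (R : realType) (n : nat) (v : 'cV[R]_n) :
  norm2 v ^+ 2 = qform 1%:M v^T.
Proof.
rewrite /norm2 sqr_sqrtr ?sumr_ge0 // => [|i _]; last exact: sqr_ge0.
by rewrite qform1; apply: eq_bigr => i _; rewrite mxE.
Qed.

Lemma norm2_mulmx_sqr (R : realType) (n p : nat) (C : 'M[R]_(p, n)) (v : 'cV[R]_n) :
  norm2 (C *m v) ^+ 2 = qform (C^T *m C) v^T.
Proof. by rewrite norm2_sqr trmx_mul qform_mulmx trmxK mulmx1. Qed.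

Lemma sqrte_lty (R : realType) (x : \bar R) :
  (sqrte x < +oo)%E = (x < +oo)%E.
Proof. by case: x => [r||]; rewrite ?ltry ?ltNyr. Qed.

Section L2_control.
Variables (R : realType) (m : nat) (f : R -> 'cV[R]_m).
Hypothesis hf : in_L2 f.
Local Notation leb := (@lebesgue_measure R).

Lemma L2norm_sqr : (L2norm f ^+ 2)%E
  = (\int[leb]_(s in `[0%R, +oo[) (norm2 (f s) ^+ 2)%:E)%E.
Proof.
rewrite /L2norm sqr_sqrte // integral_ge0 // => s _.
by rewrite lee_fin sqr_ge0.
Qed.

Lemma in_L2_integrable :
  leb.-integrable `[0, +oo[ (EFin \o (fun s => norm2 (f s) ^+ 2)).
Proof.
have [mf] := hf; rewrite /L2norm => flt; apply/integrableP; split.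
  apply/measurable_EFinP.
  rewrite (_ : (fun s => _) = fun s => \sum_k f s k 0 ^+ 2).
    by apply: measurable_sum => k; apply: measurable_funX; exact: mf.
  apply/funext => s; rewrite norm2_sqr qform1.
  by apply: eq_bigr => k _; rewrite mxE.
under eq_integral do rewrite /= ger0_norm ?sqr_ge0 //.
by move: flt; rewrite sqrte_lty.
Qed.

End L2_control.

Lemma in_L2_active_control (R : realType) (n m : nat) (N : 'I_m -> 'M[R]_n)
    (u : R -> 'cV[R]_m) (gamma : R) :
  in_L2 u -> in_L2 (fun t => gamma *: active_control N u t).
Proof.
move=> hu; have [mu_ _] := hu.
have mf k : measurable_fun (`[0, +oo[ : set R)
    (fun s => (gamma *: active_control N u s) k 0).
  rewrite (_ : (fun s => _) =
      fun s => (if N k == 0 then 0 else gamma) * u s k 0); last first.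
    by apply/funext => s; rewrite !mxE; case: ifP => _; rewrite ?mulr0 ?mul0r.
  by apply: measurable_funM; [exact: measurable_cst|exact: mu_].
split=> //; rewrite /L2norm.
have iu : (@lebesgue_measure R).-integrable `[0, +oo[
    (EFin \o (fun s => gamma ^+ 2 * norm2 (u s) ^+ 2)).
  have := integrableZl _ (gamma ^+ 2) (in_L2_integrable hu); exact.
rewrite sqrte_lty.
have iv : (@lebesgue_measure R).-integrable `[0, +oo[
    (EFin \o (fun s => norm2 (gamma *: active_control N u s) ^+ 2)).
  apply: le_integrable iu => //.
    apply/measurable_EFinP.
    rewrite (_ : (fun s => _) = fun s =>
        \sum_k ((gamma *: active_control N u s) k 0) ^+ 2).
      by apply: measurable_sum => k; apply: measurable_funX; exact: mf.
    apply/funext => s; rewrite norm2_sqr qform1.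
    by apply: eq_bigr => k _; rewrite mxE.
  move=> s _; rewrite /= lee_fin (ger0_norm (sqr_ge0 _)).
  rewrite (ger0_norm (mulr_ge0 (sqr_ge0 _) (sqr_ge0 _))).
  rewrite !norm2_sqr !qform1 mulr_sumr; apply: ler_sum => k _.
  rewrite !mxE exprMn; case: ifP => _; last by rewrite lexx.
  by rewrite expr0n /= mulr0 mulr_ge0 ?sqr_ge0.
by apply: (integrable_lty _ iv).
Qed.

(** Monotone convergence along the intervals [[a, a + k]] carries a bound uniform in the horizon
    over to the half-line. *)
Lemma integral_bndy_le (R : realType) (f : R -> R) (a M : R) :
  (forall t, a <= t -> 0 <= f t) ->
  (forall T, a <= T -> (@lebesgue_measure R).-integrable `[a, T] (EFin \o f)) ->
  (forall T, a <= T -> Rintegral (@lebesgue_measure R) `[a, T] f <= M) ->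
  (\int[@lebesgue_measure R]_(t in `[a, +oo[) (f t)%:E <= M%:E)%E.
Proof.
move=> f0 if_ hM; have aan k : a <= a + k%:R by rewrite lerDl ler0n.
rewrite itv_bndy_bigcup_BRight.
have cv : (\int[@lebesgue_measure R]_(t in `[a, (a + k%:R)%R]%classic) (f t)%:E)%E @[k --> \oo]
    --> (\int[@lebesgue_measure R]_(t in \bigcup_k `[a, (a + k%:R)%R]%classic) (f t)%:E)%E.
  apply: ge0_nondecreasing_set_cvg_integral => //.
  - move=> k l kl; apply/subsetPset; apply: subset_itvl.
    by rewrite bnd_simp lerD2l ler_nat.
  - by move=> k; have /integrableP[] := if_ _ (aan k).
  - by move=> k t /=; rewrite in_itv /= => /andP[at_ _]; rewrite lee_fin f0.
rewrite -(cvg_lim _ cv) //; apply: lime_le.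
  by apply/cvg_ex; eexists; exact: cv.
apply: nearW => k; have := hM _ (aan k); rewrite -lee_fin /Rintegral fineK //.
by have := integrable_fin_num _ (if_ _ (aan k)); apply.
Qed.

Theorem proposition3p2 (R : realType) (n m p : nat)
    (A : 'M[R]_n) (N : 'I_m -> 'M[R]_n) (C : 'M[R]_(p, n))
    (hA : hurwitz A)
    (u : R -> 'cV[R]_m) (hu : in_L2 u)
    (Phi : R -> R -> 'M[R]_n) (hPhi : fundamental_solution A N u Phi)
    (gamma : R) (gamma_gt0 : 0 < gamma)
    (hgamma : hurwitz (tensmx A (1%:M : 'M[R]_n) + tensmx (1%:M : 'M[R]_n) A
                + (gamma ^+ 2)^-1 *: \sum_k tensmx (N k) (N k)))
    (Z : R -> 'M[R]_n) (hZ : dual_lyapunov_flow A N C gamma Z)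
    (Q : 'M[R]_n) (hQ : Q = mx_integral `[0, +oo[ Z)
    (q : 'I_n -> 'cV[R]_n) (mu : 'I_n -> R)
    (hq : orthonormal_basis q) (hmu : forall i, Q *m q i = mu i *: q i)
    (t0 : R) (ht0 : 0 <= t0) (i : 'I_n) :
  (sqrte (\int[@lebesgue_measure R]_(t in `[t0, +oo[)
            (norm2 (C *m Phi t t0 *m q i) ^+ 2)%:E)
   <= (Num.sqrt (mu i))%:E
      * expeR ((2^-1)%:E * L2norm (fun t => gamma *: active_control N u t) ^+ 2))%E.
Proof.
have Qpsd y : 0 <= qform Q y by rewrite hQ; exact: gramian_psd hZ hgamma y.
have QE : dual_lyapunov_op A N gamma Q = - (C^T *m C).
  by rewrite hQ; exact: gramian_lyapunov_equation hZ hgamma.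
pose x t : 'rV[R]_n := (Phi t t0 *m q i)^T.
pose f t := norm2 (C *m Phi t t0 *m q i) ^+ 2.
have fE t : f t = qform (C^T *m C) (x t).
  by rewrite /f -mulmxA norm2_mulmx_sqr.
have hw := in_L2_active_control N gamma hu.
set w := (fun t => gamma *: active_control N u t) in hw *.
pose beta t := norm2 (w t) ^+ 2.
have betaE t : beta t = \sum_k (gamma * (if N k == 0 then 0 else u t k 0)) ^+ 2.
  rewrite /beta norm2_sqr qform1; apply: eq_bigr => k _.
  by rewrite /w !mxE.
have ibeta := in_L2_integrable hw.
pose B := Rintegral (@lebesgue_measure R) `[0, +oo[ beta.
have L2E : (L2norm w ^+ 2)%E = B%:E.
  rewrite L2norm_sqr /B /Rintegral fineK //.
  by have := integrable_fin_num _ ibeta; apply.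
have x0Q : qform Q (x t0) = mu i.
  rewrite /x (fundamental_solution_id hPhi ht0) mul1mx /qform trmxK -mulmxA.
  by rewrite hmu -scalemxAr hq eqxx mxE mxE eqxx mulr1.
have mu0 : 0 <= mu i by rewrite -x0Q.
have energy T : t0 <= T ->
    (@lebesgue_measure R).-integrable `[t0, T] (EFin \o f) /\
    Rintegral (@lebesgue_measure R) `[t0, T] f <= mu i * expR B.
  move=> t0T.
  have if_ : (@lebesgue_measure R).-integrable `[t0, T] (EFin \o f).
    have cf := trajectory_qform_continuous (v := q i) (M := C^T *m C) hPhi ht0 t0T.
    have := continuous_compact_integrable (@segment_compact _ t0 T) cf.
    by congr (_.-integrable _ _); apply/funext => t; rewrite /= fE.
  split=> //.
  have sub0 : `[t0, T] `<=` `[0, +oo[ by apply: subset_itv; rewrite bnd_simp.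
  have ibT : (@lebesgue_measure R).-integrable `[t0, T] (EFin \o beta).
    exact: integrableS ibeta.
  (* Adding the output energy up to time [t], which is nonnegative, turns the dissipation inequality
     into [y' <= V beta <= y beta]. This energy is zero at [t0], so [y t0 = mu i]; at [T] the
     nonnegative [V] is dropped. *)
  pose y t := qform Q (x t) + Rintegral (@lebesgue_measure R) `[t0, t] f.
  have f0 t : 0 <= f t by exact: sqr_ge0.
  have J0 t : 0 <= Rintegral (@lebesgue_measure R) `[t0, t] f.
    by apply: Rintegral_ge0 => s _; exact: f0.
  have py := primitiveD (trajectory_qform_primitive (q i) hPhi ht0 t0T Q)
    (primitive_Rintegral if_).
  have := gronwall t0T ibT _ py; rewrite -!/(y _) => gw.
  have {gw} yT : y T <= mu i * expR (Rintegral (@lebesgue_measure R) `[t0, T] beta).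
    rewrite -x0Q -[qform Q (x t0)]addr0 -(Rintegral_itv11 f t0).
    apply: gw.
    - by move=> t _ _; exact: sqr_ge0.
    - by move=> t _ _; rewrite addr_ge0.
    - move=> t _ _; rewrite fE.
      apply: (@le_trans _ _ (qform Q (x t) * beta t)).
        by rewrite betaE; exact: lyapunov_dissipation gamma_gt0 Qpsd QE _.
      by rewrite ler_wpM2r ?sqr_ge0 // lerDl.
  apply: (@le_trans _ _ (y T)); first by rewrite /y lerDr.
  apply: le_trans yT (ler_wpM2l mu0 _); rewrite ler_expR.
  rewrite -lee_fin /B /Rintegral !fineK; last 2 first.
  - by have := integrable_fin_num _ ibeta; apply.
  - by have := integrable_fin_num _ ibT; apply.
  apply: ge0_subset_integral => //.
  - by case/integrableP : ibeta.
  - by move=> t _; rewrite lee_fin sqr_ge0.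
have bound : (\int[@lebesgue_measure R]_(t in `[t0, +oo[) (f t)%:E
    <= (mu i * expR B)%:E)%E.
  apply: integral_bndy_le => [t _|T|T]; first exact: sqr_ge0.
  - by move=> /energy[].
  - by move=> /energy[].
have muB : 0 <= mu i * expR B by rewrite mulr_ge0 ?expR_ge0.
rewrite L2E; apply: (@le_trans _ _ (sqrte (mu i * expR B)%:E)).
  by rewrite lee_sqrt ?lee_fin.
rewrite /= -EFinM lee_fin sqrtrM // ler_wpM2l ?sqrtr_ge0 //.
rewrite (_ : expR B = expR (2^-1 * B) ^+ 2); last first.
  by rewrite expr2 -expRD; congr expR; field.
by rewrite sqrtr_sqr ger0_norm ?expR_ge0.
Qed.
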